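(* Let $f\in\mathcal{U}$ be of the form $f(z)=z+a_2z^2+a_3z^3+\cdots$. Then (i) $|a_2a_3-a_4|\le 2$; (ii) $|a_2a_4-a_5|\le 3$. These inequalities are sharp in the class $\mathcal{U}$, with equality in both (i) and (ii) for the Koebe function $k(z)=\frac{z}{(1-z)^2}=z+\sum_{n=2}^{\infty}nz^n$ and its rotations $e^{-i\theta}k(e^{i\theta}z)$, $\theta\in\mathbb{R}$.
   Context: Let $\mathbb{D}=\{z\in\mathbb{C}:|z|<1\}$ be the open unit disk, and let $\mathcal{A}$ be the class of functions $f$ analytic in $\mathbb{D}$ of the form $f(z)=z+a_2z^2+a_3z^3+\cdots$ (so $a_n$ denotes the $n$-th Taylor coefficient of $f$ at $0$, with $f(0)=0$, $f'(0)=1$). The class $\mathcal{U}$ is $$\mathcal{U}=\left\{f\in\mathcal{A}:\left|\left(\frac{z}{f(z)}\right)^2f'(z)-1\right|<1 \text{ for all } z\in\mathbb{D}\right\}.$$ Here $z/f(z)$ is understood to take the value $1$ at $z=0$ (removable singularity), and the condition includes that the expression is defined, i.e. $f(z)\neq 0$ for $z\in\mathbb{D}\setminus\{0\}$. *)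

(* Defs.v *)
From Stdlib Require Import Reals.
From Coquelicot Require Import Coquelicot.

(* A function on the unit disk is a total map [C -> C] of which only the values
   on the disk are ever constrained. *)

Local Open Scope C_scope.

Definition in_disk (z : C) : Prop := (Cmod z < 1)%R.

Definition analytic_in_disk (f : C -> C) : Prop :=
  forall z : C, in_disk z -> ex_derive f z.

(* By uniqueness of power series expansions, [a] is determined by [f]:
   [a n] is the n-th Taylor coefficient of [f] at 0. *)
Definition taylor_expansion (f : C -> C) (a : nat -> C) : Prop :=
  forall z : C, in_disk z -> is_pseries a z (f z).

Definition class_A (f : C -> C) : Prop :=
  analytic_in_disk f /\
  exists a : nat -> C,
    a 0%nat = RtoC 0 /\ a 1%nat = RtoC 1 /\ taylor_expansion f a.

(* z / f(z), with its removable singularity at 0 filled in when f is in A. *)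
Definition z_over (f : C -> C) (z : C) : C :=
  if Ceq_dec z (RtoC 0) then RtoC 1 else z / f z.

(* Division by zero is total in [C], so the nonvanishing of [f] that makes
   z / f(z) meaningful is a separate clause. [C_derive] is the complex
   derivative wherever [ex_derive] holds, hence on the whole disk for [f] in A. *)
Definition class_U (f : C -> C) : Prop :=
  class_A f /\
  (forall z : C, in_disk z -> z <> RtoC 0 -> f z <> RtoC 0) /\
  (forall z : C, in_disk z ->
     (Cmod (z_over f z ^ 2 * C_derive f z - RtoC 1) < 1)%R).

Definition koebe (z : C) : C := z / (RtoC 1 - z) ^ 2.

(* e^{i theta} *)
Definition cis (theta : R) : C := (cos theta, sin theta).

Definition rotation (theta : R) (f : C -> C) (z : C) : C :=
  cis (- theta) * f (cis theta * z).

(* Main.v *)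
Require Import Defs.
From Stdlib Require Import Reals Lra Lia Classical ClassicalEpsilon.
From Coquelicot Require Import Coquelicot.

Local Open Scope C_scope.

(** Write [z / f z = 1 - a2 z + b2 z^2 + b3 z^3 + ...], so that
    [1 / f z = 1 / z - a2 + psi z] with [psi z = b2 z + b3 z^2 + b4 z^3 + ...].
    Comparing coefficients in [f z * (z / f z) = z] gives
    [a3 = a2^2 - b2], [a2 a3 - a4 = b3 + a2 b2] and
    [a2 a4 - a5 = b4 + b2 a3 + b3 a2], so everything reduces to the bounds
    [|a2| <= 2], [|a3| <= 3], [2 |b3| <= 1 - |b2|^2] and [3 |b4| <= 1 - |b2|^2].

    The defining inequality of the class involves [f] only through [1 / f]: it says
    [|z^2 psi' z| < 1] ([U_functional_of_reciprocal]).  By the Schwarz lemma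
    [|psi'| <= 1] on the disk; hence [psi] is 1-Lipschitz, and the Schwarz-Pick bound
    ([schwarz_pick_coefficient]) for [psi'] and for its even part gives the
    inequalities on [b3] and [b4].

    The bounds on [a2] and [a3] come from [f] having no pole, that is, from
    [1 / v + psi v] omitting the value [a2].  With [k = 1 / v], the equation
    [k + psi (1 / k) = x], [|k| > 1], is solvable for large [x], and as [psi] is
    1-Lipschitz a solution with [|k| >= sigma > 1] can be continued by a contraction to
    all [x] in a disk whose radius depends on [sigma] only.  So if all solutions on the
    ray [t a2], [t >= 1], keep a fixed distance from the unit circle, then [a2] itself
    would be attained ([solve_by_continuation]).  If [|a2| > 2] this distance is given by
    the triangle inequality.  If [|a2^2 - b2| > 3] it is given by the Schwarz-Pick bound
    for [(psi z - psi v) / (1 - conj v * z)], which is bounded by one as [psi] is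
    1-Lipschitz: that bound controls [x^2 - b2] by a function of [|k|] which equals 3 at
    [|k| = 1], while [|x^2 - b2|] does not decrease when [x] moves outwards on the ray.

    The function theory rests on two elementary facts.  A power series may be
    differentiated term by term, so that quotients of power series are differentiable as
    often as needed; and [|F|^2 + e |z|^2] has no local maximum for [F] twice complex
    differentiable and [e > 0], which yields the maximum principle without integration.

    Equality is computed on [z / (1 - c z)^2] with [|c| = 1], whose coefficients are
    [n c^(n-1)] and for which [psi z = c^2 z]. *)

(** * Complex differentiation in epsilon-delta form *)

Lemma is_derive_C_iff (f : C -> C) (z l : C) :
  is_derive f z l <->
  forall eps : R, (0 < eps)%R -> exists delta : R, (0 < delta)%R /\
    forall w : C, (Cmod (w - z) < delta)%R ->
      (Cmod (f w - f z - (w - z) * l) <= eps * Cmod (w - z))%R.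
Proof.
  split.
  - intros [_ H] eps Heps.
    destruct (H z (fun P HP => HP) (mkposreal eps Heps)) as [d Hd].
    exists d; split; [apply cond_pos|].
    intros w Hw. exact (Hd w Hw).
  - intros H; split.
    + exact (is_linear_scal_l (K := C_AbsRing) (V := C_NormedModule) l).
    + intros x Hx.
      apply (is_filter_lim_locally_unique (V := AbsRing_NormedModule C_AbsRing)) in Hx.
      subst x. intros eps.
      destruct (H eps (cond_pos eps)) as [d [Hd Hw]].
      exists (mkposreal d Hd). intros w Hball. exact (Hw w Hball).
Qed.

Lemma Cmod_sub_sym (z w : C) : Cmod (z - w) = Cmod (w - z).
Proof. rewrite <- Cmod_opp. f_equal. ring. Qed.

Lemma Cmod_triangle_sub (z w : C) : (Cmod (z - w) <= Cmod z + Cmod w)%R.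
Proof. unfold Cminus. rewrite <- (Cmod_opp w). apply Cmod_triangle. Qed.

Lemma Cmod_triangle_rev (z w : C) : (Cmod z - Cmod w <= Cmod (z - w))%R.
Proof.
  generalize (Cmod_triangle (z - w) w).
  replace (z - w + w) with z by ring. lra.
Qed.

Lemma is_derive_continuous (f : C -> C) (z l : C) :
  is_derive f z l ->
  forall eps : R, (0 < eps)%R -> exists delta : R, (0 < delta)%R /\
    forall w : C, (Cmod (w - z) < delta)%R -> (Cmod (f w - f z) < eps)%R.
Proof.
  intros H eps Heps.
  destruct (proj1 (is_derive_C_iff f z l) H 1%R Rlt_0_1) as [d [Hd Hw]].
  generalize (Cmod_ge_0 l); intros Hl.
  exists (Rmin d (eps / (2 + Cmod l))). split.
  - apply Rmin_glb_lt; [lra|]. apply Rdiv_lt_0_compat; lra.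
  - intros w Hlt.
    generalize (Rmin_l d (eps / (2 + Cmod l))) (Rmin_r d (eps / (2 + Cmod l))); intros H1 H2.
    assert (Hw1 := Hw w ltac:(lra)).
    replace (f w - f z) with ((f w - f z - (w - z) * l) + (w - z) * l) by ring.
    apply Rle_lt_trans with (1 := Cmod_triangle _ _). rewrite Cmod_mult.
    apply Rle_lt_trans with (Cmod (w - z) * (1 + Cmod l))%R; [lra|].
    apply Rle_lt_trans with (eps / (2 + Cmod l) * (1 + Cmod l))%R.
    + apply Rmult_le_compat_r; lra.
    + apply Rmult_lt_reg_r with (2 + Cmod l)%R; [lra|].
      field_simplify; [|lra]. nra.
Qed.

Lemma is_derive_Cplus (f g : C -> C) (z l m : C) :
  is_derive f z l -> is_derive g z m ->
  is_derive (fun w => f w + g w) z (l + m).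
Proof. exact (is_derive_plus f g z l m). Qed.

Lemma is_derive_Cconst (c z : C) : is_derive (fun _ : C => c) z (RtoC 0).
Proof. exact (is_derive_const c z). Qed.

Lemma is_derive_Cid (z : C) : is_derive (fun w : C => w) z (RtoC 1).
Proof.
  apply is_derive_C_iff. intros eps Heps. exists 1%R; split; [lra|].
  intros w _. replace (w - z - (w - z) * 1) with (RtoC 0) by ring.
  rewrite Cmod_0. generalize (Cmod_ge_0 (w - z)); nra.
Qed.

(** The complex numbers carry two normed-module structures over themselves, with the
    same norm but different uniform structures. Differentiability depends on the norm
    only, and this transfers the product and chain rules, which are stated for the
    former structure, to the latter. *)
Lemma is_derive_C_AbsRing (f : C -> C) (z l : C) :
  is_derive (V := AbsRing_NormedModule C_AbsRing) f z l <->
  is_derive (V := C_NormedModule) f z l.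
Proof.
  split; intros [_ H].
  - split; [exact (is_linear_scal_l (K := C_AbsRing) (V := C_NormedModule) l)|].
    exact H.
  - split; [exact (is_linear_scal_l (K := C_AbsRing) (V := AbsRing_NormedModule C_AbsRing) l)|].
    exact H.
Qed.

Lemma is_derive_Cmult (f g : C -> C) (z l m : C) :
  is_derive f z l -> is_derive g z m ->
  is_derive (fun w => f w * g w) z (l * g z + f z * m).
Proof.
  intros Hf Hg. apply is_derive_C_AbsRing.
  apply (is_derive_mult (K := C_AbsRing)); try apply is_derive_C_AbsRing; try assumption.
  exact Cmult_comm.
Qed.

Lemma is_derive_Ccomp (f g : C -> C) (z l m : C) :
  is_derive f (g z) l -> is_derive g z m ->
  is_derive (fun w => f (g w)) z (m * l).
Proof.
  intros Hf Hg.
  apply (is_derive_comp (K := C_AbsRing) (V := C_NormedModule)); [exact Hf|].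
  apply is_derive_C_AbsRing, Hg.
Qed.

Lemma is_derive_Cinv_id (z : C) :
  z <> 0 -> is_derive (fun w => / w) z (- / z * / z).
Proof.
  intros Hz. apply is_derive_C_iff. intros eps Heps.
  assert (Hm := proj1 (Cmod_gt_0 z) Hz).
  set (m := Cmod z) in *.
  exists (Rmin (m / 2) (eps * m ^ 3 / 2)). split.
  { apply Rmin_glb_lt; [lra|]. generalize (pow_lt m 3 Hm); nra. }
  intros w Hw.
  generalize (Rmin_l (m / 2) (eps * m ^ 3 / 2)) (Rmin_r (m / 2) (eps * m ^ 3 / 2)); intros H1 H2.
  assert (Hwm : (m / 2 <= Cmod w)%R).
  { generalize (Cmod_triangle_rev z w). rewrite Cmod_sub_sym. fold m. lra. }
  assert (Hw0 : w <> 0) by (apply Cmod_gt_0; lra).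
  replace (/ w - / z - (w - z) * (- / z * / z))
    with ((w - z) * (w - z) * (/ w * (/ z * / z))) by (field; auto).
  rewrite !Cmod_mult, !Cmod_inv; auto. fold m.
  set (d := Cmod (w - z)) in *.
  assert (Hd : (0 <= d)%R) by apply Cmod_ge_0.
  assert (Hiw : (/ Cmod w <= 2 / m)%R).
  { replace (2 / m)%R with (/ (m / 2))%R by (field; lra).
    apply Rinv_le_contravar; lra. }
  assert (Him := Rinv_0_lt_compat m Hm).
  apply Rle_trans with (d * d * (2 / m * (/ m * / m)))%R.
  { apply Rmult_le_compat_l; [nra|]. apply Rmult_le_compat_r; [nra|exact Hiw]. }
  replace (d * d * (2 / m * (/ m * / m)))%R with (d * (2 / m ^ 3) * d)%R by (field; lra).
  apply Rmult_le_compat_r; [exact Hd|].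
  apply Rmult_le_reg_r with (m ^ 3 / 2)%R; [generalize (pow_lt m 3 Hm); lra|].
  replace (d * (2 / m ^ 3) * (m ^ 3 / 2))%R with d by (field; lra). lra.
Qed.

Lemma is_derive_Cinv (f : C -> C) (z l : C) :
  is_derive f z l -> f z <> 0 ->
  is_derive (fun w => / f w) z (l * (- / f z * / f z)).
Proof.
  intros Hf Hz.
  exact (is_derive_Ccomp Cinv f z _ l (is_derive_Cinv_id (f z) Hz) Hf).
Qed.

Lemma is_derive_C_eq (f : C -> C) (z l m : C) :
  is_derive f z l -> l = m -> is_derive f z m.
Proof. intros H <-. exact H. Qed.

(** * Mean value inequality and Taylor expansion *)

Lemma Cmod_sqr_Re (z : C) : Re (Cconj z * z) = (Cmod z ^ 2)%R.
Proof. rewrite Cmod2_alt. destruct z as [x y]. simpl. ring. Qed.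

Lemma Re_mult_sub (c u v : C) : (Re (c * u)%C - Re (c * v)%C)%R = Re (c * (u - v))%C.
Proof. destruct c, u, v. simpl. ring. Qed.

Lemma is_derive_Re_on_segment (f : C -> C) (c z h l : C) (t : R) :
  is_derive f (z + RtoC t * h) l ->
  derivable_pt_lim (fun s => Re (c * f (z + RtoC s * h))) t (Re (c * (h * l))).
Proof.
  intros H eps Heps.
  generalize (Cmod_ge_0 c) (Cmod_ge_0 h); intros Hc Hh.
  set (e := (eps / (2 * ((1 + Cmod c) * (1 + Cmod h))))%R).
  assert (He : (0 < e)%R) by (apply Rdiv_lt_0_compat; nra).
  destruct (proj1 (is_derive_C_iff _ _ _) H e He) as [d [Hd Hw]].
  assert (Hd' : (0 < d / (1 + Cmod h))%R) by (apply Rdiv_lt_0_compat; lra).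
  exists (mkposreal _ Hd'). intros s Hs0 Hs. simpl in Hs.
  assert (Hdiff : z + RtoC (t + s) * h - (z + RtoC t * h) = RtoC s * h)
    by (rewrite RtoC_plus; ring).
  assert (Hsm : (0 < Rabs s)%R) by (apply Rabs_pos_lt; exact Hs0).
  specialize (Hw (z + RtoC (t + s) * h)).
  rewrite Hdiff, Cmod_mult, Cmod_R in Hw.
  assert (Hsd : (Rabs s * Cmod h < d)%R).
  { apply Rle_lt_trans with (Rabs s * (1 + Cmod h))%R; [nra|].
    apply Rmult_lt_reg_r with (/ (1 + Cmod h))%R; [apply Rinv_0_lt_compat; lra|].
    rewrite Rmult_assoc, Rinv_r by lra. unfold Rdiv in Hs. lra. }
  specialize (Hw Hsd).
  set (D := f (z + RtoC (t + s) * h) - f (z + RtoC t * h) - RtoC s * h * l) in *.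
  assert (HD : ((Re (c * f (z + RtoC (t + s) * h))%C - Re (c * f (z + RtoC t * h))%C) / s
                - Re (c * (h * l))%C = Re (c * D)%C / s)%R).
  { unfold D. destruct c as [c1 c2], h as [h1 h2], l as [l1 l2].
    destruct (f (z + RtoC (t + s) * (h1, h2))) as [u1 u2].
    destruct (f (z + RtoC t * (h1, h2))) as [v1 v2]. simpl. field. exact Hs0. }
  rewrite HD. unfold Rdiv. rewrite Rabs_mult, Rabs_inv.
  apply Rmult_lt_reg_r with (Rabs s); [exact Hsm|].
  rewrite Rmult_assoc, Rinv_l, Rmult_1_r by lra.
  apply Rle_lt_trans with (1 := re_le_Cmod _). rewrite Cmod_mult.
  apply Rle_lt_trans with (Cmod c * (e * (Rabs s * Cmod h)))%R; [nra|].
  apply Rle_lt_trans with (e * ((1 + Cmod c) * (1 + Cmod h)) * Rabs s)%R.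
  { replace (Cmod c * (e * (Rabs s * Cmod h)))%R with (e * (Cmod c * Cmod h) * Rabs s)%R by ring.
    apply Rmult_le_compat_r; [lra|]. apply Rmult_le_compat_l; [lra|]. nra. }
  apply Rmult_lt_compat_r; [exact Hsm|].
  replace (e * ((1 + Cmod c) * (1 + Cmod h)))%R with (eps / 2)%R; [lra|].
  unfold e. field. split; lra.
Qed.

(** The real mean value theorem, applied to the component of [f] along its own
    increment. *)
Lemma mean_value_inequality (f f' : C -> C) (z h : C) (M : R) :
  (forall t, (0 <= t <= 1)%R -> is_derive f (z + RtoC t * h) (f' (z + RtoC t * h))) ->
  (forall t, (0 <= t <= 1)%R -> (Cmod (f' (z + RtoC t * h)%C) <= M)%R) ->
  (Cmod (f (z + h)%C - f z) <= M * Cmod h)%R.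
Proof.
  intros Hd HM.
  set (D := f (z + h) - f z).
  destruct (MVT_cor2 (fun s => Re (Cconj D * f (z + RtoC s * h)))
     (fun s => Re (Cconj D * (h * f' (z + RtoC s * h)))) 0 1 Rlt_0_1) as [t [Ht1 Ht2]].
  { intros t Ht. apply is_derive_Re_on_segment, Hd, Ht. }
  replace (z + RtoC 1 * h) with (z + h) in Ht1 by ring.
  replace (z + RtoC 0 * h) with z in Ht1 by ring.
  assert (Hsq : (Re (Cconj D * f (z + h))%C - Re (Cconj D * f z)%C = Cmod D ^ 2)%R).
  { rewrite <- Cmod_sqr_Re. apply Re_mult_sub. }
  rewrite Hsq in Ht1.
  assert (Hle : (Cmod D ^ 2 <= Cmod D * (Cmod h * M))%R).
  { rewrite Ht1, Rminus_0_r, Rmult_1_r.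
    apply Rle_trans with (1 := Rle_abs _). apply Rle_trans with (1 := re_le_Cmod _).
    rewrite !Cmod_mult, Cmod_conj.
    apply Rmult_le_compat_l; [apply Cmod_ge_0|].
    apply Rmult_le_compat_l; [apply Cmod_ge_0|]. apply HM. lra. }
  destruct (Rle_lt_or_eq_dec 0 (Cmod D) (Cmod_ge_0 D)) as [Hp|H0].
  - apply Rmult_le_reg_l with (Cmod D); [exact Hp|]. nra.
  - rewrite <- H0. generalize (HM 0%R ltac:(lra)) (Cmod_ge_0 (f' (z + RtoC 0 * h))) (Cmod_ge_0 h).
    nra.
Qed.

(** The mean value inequality applied to [f] minus its Taylor polynomial, whose
    derivative is small because [f'] is differentiable at [z]. *)
Lemma taylor_second_order (f f' : C -> C) (z c : C) (r : R) :
  (0 < r)%R ->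
  (forall w, (Cmod (w - z) < r)%R -> is_derive f w (f' w)) ->
  is_derive f' z c ->
  forall eps : R, (0 < eps)%R -> exists delta : R, (0 < delta)%R /\
    forall h : C, (Cmod h < delta)%R ->
      (Cmod (f (z + h)%C - (f z + h * f' z + h * h * (c / 2))) <= eps * Cmod h ^ 2)%R.
Proof.
  intros Hr Hf Hf' eps Heps.
  destruct (proj1 (is_derive_C_iff _ _ _) Hf' eps Heps) as [d [Hd Hw]].
  exists (Rmin d r). split; [apply Rmin_glb_lt; assumption|].
  intros h Hh.
  generalize (Rmin_l d r) (Rmin_r d r); intros H1 H2.
  set (g := fun w => f w + (- f' z * w + - (c / 2) * ((w - z) * (w - z)))).
  assert (Hseg : forall t, (0 <= t <= 1)%R -> (Cmod (z + RtoC t * h - z) <= Cmod h)%R).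
  { intros t Ht. replace (z + RtoC t * h - z) with (RtoC t * h) by ring.
    rewrite Cmod_mult, Cmod_R, Rabs_pos_eq by lra. generalize (Cmod_ge_0 h). nra. }
  assert (H := mean_value_inequality g (fun w => f' w - f' z - (w - z) * c) z h (eps * Cmod h)).
  replace (f (z + h) - (f z + h * f' z + h * h * (c / 2))) with (g (z + h) - g z).
  2:{ unfold g. field. }
  replace (eps * Cmod h ^ 2)%R with (eps * Cmod h * Cmod h)%R by ring.
  apply H.
  - intros t Ht. specialize (Hseg t Ht). set (w := z + RtoC t * h) in *.
    eapply is_derive_C_eq.
    + apply is_derive_Cplus; [apply Hf; lra|].
      apply is_derive_Cplus.
      * apply is_derive_Cmult; [apply is_derive_Cconst|apply is_derive_Cid].
      * apply is_derive_Cmult; [apply is_derive_Cconst|].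
        apply is_derive_Cmult; (apply is_derive_Cplus; [apply is_derive_Cid|apply is_derive_Cconst]).
    + cbv beta; fold w; field.
  - intros t Ht. specialize (Hseg t Ht).
    apply Rle_trans with (1 := Hw (z + RtoC t * h) ltac:(lra)). apply Rmult_le_compat_l; lra.
Qed.

(** * Extrema on closed disks *)

Lemma bounded_seq_cluster (x : nat -> R) (rho : R) :
  (forall n, (Rabs (x n) <= rho)%R) ->
  exists l : R, forall (eps : R) (N : nat), (0 < eps)%R ->
    exists p, (N <= p)%nat /\ (Rabs (x p - l) < eps)%R.
Proof.
  intros Hx.
  destruct (Bolzano_Weierstrass x (fun c => (- rho <= c <= rho)%R) (compact_P3 _ _)) as [l Hl].
  { intros n. apply Rabs_le_between, Hx. }
  exists l. intros eps N Heps.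
  destruct (Hl (disc l (mkposreal eps Heps)) N) as [p [Hp Hd]].
  - exists (mkposreal eps Heps). intros y Hy. exact Hy.
  - exists p. split; [exact Hp|exact Hd].
Qed.

(** Bolzano-Weierstrass in the plane: extract along the first coordinate, then apply
    the one-dimensional theorem to the second coordinate of the extracted sequence. *)
Lemma closed_disk_cluster (z : nat -> C) (rho : R) :
  (forall n, (Cmod (z n) <= rho)%R) ->
  exists l : C, (Cmod l <= rho)%R /\ forall (eps : R) (N : nat), (0 < eps)%R ->
    exists p, (N <= p)%nat /\ (Cmod (z p - l) < eps)%R.
Proof.
  intros Hz.
  assert (Hb : forall n, (Rabs (fst (z n)) <= rho)%R /\ (Rabs (snd (z n)) <= rho)%R).
  { intros n. generalize (Rmax_Cmod (z n)) (Hz n) (Rmax_l (Rabs (fst (z n))) (Rabs (snd (z n))))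
      (Rmax_r (Rabs (fst (z n))) (Rabs (snd (z n)))). lra. }
  destruct (bounded_seq_cluster (fun n => fst (z n)) rho (fun n => proj1 (Hb n))) as [x Hx].
  assert (Hex : forall k : nat, exists p,
    (k <= p)%nat /\ (Rabs (fst (z p) - x) < / INR (S k))%R).
  { intros k. apply (Hx (/ INR (S k))%R k). apply Rinv_0_lt_compat, lt_0_INR. lia. }
  set (q := fun k => proj1_sig (constructive_indefinite_description _ (Hex k))).
  assert (Hq : forall k, (k <= q k)%nat /\ (Rabs (fst (z (q k)) - x) < / INR (S k))%R).
  { intros k. exact (proj2_sig (constructive_indefinite_description _ (Hex k))). }
  destruct (bounded_seq_cluster (fun k => snd (z (q k))) rho (fun k => proj2 (Hb (q k)))) as [y Hy].
  assert (Hcl : forall (eps : R) (N : nat), (0 < eps)%R ->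
    exists p, (N <= p)%nat /\ (Cmod (z p - (x, y)) < eps)%R).
  { intros eps N Heps.
    destruct (archimed_cor1 (eps / 2)) as [N1 [HN1 HN1']]; [lra|].
    destruct (Hy (eps / 2)%R (N + N1)%nat) as [k [Hk Hky]]; [lra|].
    destruct (Hq k) as [Hqk Hqx]. exists (q k). split; [lia|].
    assert (Hkk : (/ INR (S k) < eps / 2)%R).
    { apply Rle_lt_trans with (2 := HN1). apply Rinv_le_contravar.
      - apply lt_0_INR. lia.
      - apply le_INR. lia. }
    apply Rle_lt_trans with (1 := Cmod_2Rmax _).
    assert (Hs : (sqrt 2 < 2)%R).
    { rewrite <- (sqrt_Rsqr 2) at 2 by lra. apply sqrt_lt_1; unfold Rsqr; lra. }
    assert (Hs0 := sqrt_pos 2).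
    assert (Hm : (0 <= Rmax (Rabs (fst (z (q k) - (x, y))%C)) (Rabs (snd (z (q k) - (x, y))%C)) < eps / 2)%R).
    { split.
      - apply Rle_trans with (2 := Rmax_l _ _). apply Rabs_pos.
      - apply Rmax_lub_lt; simpl.
        + unfold Rminus in Hqx. lra.
        + unfold Rminus in Hky. exact Hky. }
    nra. }
  exists (x, y). split; [|exact Hcl].
  apply Rnot_lt_le. intros Hlt.
  destruct (Hcl (Cmod (x, y) - rho)%R 0%nat) as [p [_ Hp]]; [lra|].
  generalize (Cmod_triangle_rev (x, y) (z p)) (Hz p). rewrite Cmod_sub_sym. lra.
Qed.

Lemma closed_disk_max (u : C -> R) (rho : R) :
  (0 <= rho)%R ->
  (forall z, (Cmod z <= rho)%R -> forall eps : R, (0 < eps)%R ->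
     exists delta : R, (0 < delta)%R /\
       forall w, (Cmod w <= rho)%R -> (Cmod (w - z) < delta)%R -> (Rabs (u w - u z) < eps)%R) ->
  exists z0, (Cmod z0 <= rho)%R /\ forall z, (Cmod z <= rho)%R -> (u z <= u z0)%R.
Proof.
  intros Hrho Hu.
  set (E := fun x : R => exists z, (Cmod z <= rho)%R /\ x = u z).
  assert (Hbound : bound E).
  { apply NNPP. intros Hnb.
    assert (Hex : forall n : nat, exists z, (Cmod z <= rho)%R /\ (INR n < u z)%R).
    { intros n. apply NNPP. intros Hn. apply Hnb. exists (INR n). intros x [z [Hz ->]].
      apply Rnot_lt_le. intros Hlt. apply Hn. exists z. tauto. }
    set (q := fun k => proj1_sig (constructive_indefinite_description _ (Hex k))).
    assert (Hq : forall k, (Cmod (q k) <= rho)%R /\ (INR k < u (q k))%R)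
      by (intros k; exact (proj2_sig (constructive_indefinite_description _ (Hex k)))).
    destruct (closed_disk_cluster q rho (fun k => proj1 (Hq k))) as [l [Hl Hcl]].
    destruct (Hu l Hl 1%R Rlt_0_1) as [d [Hd Hw]].
    destruct (nfloor_ex (Rabs (u l) + 1)) as [N [_ HN]]; [generalize (Rabs_pos (u l)); lra|].
    destruct (Hcl d (S N) Hd) as [p [HNp Hp]].
    assert (HINR : (INR N + 1 <= INR p)%R) by (rewrite <- S_INR; apply le_INR; lia).
    generalize (Hw _ (proj1 (Hq p)) Hp) (proj2 (Hq p)) (Rle_abs (u l)) (Rle_abs (u (q p) - u l)). lra. }
  destruct (completeness E Hbound) as [M [HM1 HM2]].
  { exists (u 0). exists 0. rewrite Cmod_0. auto. }
  assert (Hex : forall n : nat, exists z, (Cmod z <= rho)%R /\ (M - / INR (S n) < u z)%R).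
  { intros n. apply NNPP. intros Hn.
    assert (Hpos : (0 < / INR (S n))%R) by (apply Rinv_0_lt_compat, lt_0_INR; lia).
    assert (Hub : is_upper_bound E (M - / INR (S n))%R).
    { intros x [z [Hz ->]]. apply Rnot_lt_le. intros Hlt. apply Hn. exists z. tauto. }
    generalize (HM2 _ Hub). lra. }
  set (q := fun k => proj1_sig (constructive_indefinite_description _ (Hex k))).
  assert (Hq : forall k, (Cmod (q k) <= rho)%R /\ (M - / INR (S k) < u (q k))%R)
    by (intros k; exact (proj2_sig (constructive_indefinite_description _ (Hex k)))).
  destruct (closed_disk_cluster q rho (fun k => proj1 (Hq k))) as [l [Hl Hcl]].
  exists l. split; [exact Hl|]. intros z Hz.
  apply Rle_trans with M; [apply HM1; exists z; auto|].
  apply Rnot_lt_le. intros Hlt.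
  destruct (Hu l Hl ((M - u l) / 2)%R) as [d [Hd Hw]]; [lra|].
  destruct (archimed_cor1 ((M - u l) / 2)) as [N [HN HN']]; [lra|].
  destruct (Hcl d N Hd) as [p [HNp Hp]].
  assert (Hkk : (/ INR (S p) < (M - u l) / 2)%R).
  { apply Rle_lt_trans with (2 := HN). apply Rinv_le_contravar.
    - apply lt_0_INR. lia.
    - apply le_INR. lia. }
  generalize (Hw _ (proj1 (Hq p)) Hp) (proj2 (Hq p)) (Rle_abs (u (q p) - u l)). lra.
Qed.

(** * Iterated complex differentiability on the disk *)

(** Differentiability of order [n] rather than holomorphy: without Cauchy's theorem,
    one derivative gives no information on the next, and the maximum principle below
    consumes two of them. *)
Fixpoint holo (n : nat) (f : C -> C) : Prop :=
  match n with
  | O => True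
  | S m => exists f' : C -> C,
      (forall z, in_disk z -> is_derive f z (f' z)) /\ holo m f'
  end.

Lemma holo_pred (n : nat) : forall f, holo (S n) f -> holo n f.
Proof.
  induction n as [|n IH]; intros f [f' [H1 H2]]; [exact I|].
  exists f'. split; [exact H1|]. apply IH, H2.
Qed.

Lemma holo_const (n : nat) : forall c, holo n (fun _ => c).
Proof.
  induction n as [|n IH]; intros c; [exact I|].
  exists (fun _ => RtoC 0). split; [|apply IH].
  intros z _. apply is_derive_Cconst.
Qed.

Lemma holo_id (n : nat) : holo n (fun z => z).
Proof.
  destruct n as [|n]; [exact I|].
  exists (fun _ => RtoC 1). split; [|apply holo_const].
  intros z _. apply is_derive_Cid.
Qed.

Lemma holo_plus (n : nat) : forall f g, holo n f -> holo n g -> holo n (fun z => f z + g z).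
Proof.
  induction n as [|n IH]; intros f g Hf Hg; [exact I|].
  destruct Hf as [f' [Hf Hf']], Hg as [g' [Hg Hg']].
  exists (fun z => f' z + g' z). split; [|apply IH; assumption].
  intros z Hz. apply is_derive_Cplus; auto.
Qed.

Lemma holo_mult (n : nat) : forall f g, holo n f -> holo n g -> holo n (fun z => f z * g z).
Proof.
  induction n as [|n IH]; intros f g Hf Hg; [exact I|].
  assert (Hf0 := holo_pred _ _ Hf). assert (Hg0 := holo_pred _ _ Hg).
  destruct Hf as [f' [Hf Hf']], Hg as [g' [Hg Hg']].
  exists (fun z => f' z * g z + f z * g' z). split; [|apply holo_plus; apply IH; assumption].
  intros z Hz. apply is_derive_Cmult; auto.
Qed.

Lemma holo_opp (n : nat) (f : C -> C) : holo n f -> holo n (fun z => - f z).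
Proof.
  revert f. induction n as [|n IH]; intros f Hf; [exact I|].
  destruct Hf as [f' [Hf Hf']].
  exists (fun z => - f' z). split; [|apply IH; assumption].
  intros z Hz. exact (is_derive_opp f z (f' z) (Hf z Hz)).
Qed.

Lemma holo_minus (n : nat) (f g : C -> C) :
  holo n f -> holo n g -> holo n (fun z => f z - g z).
Proof. intros Hf Hg. apply holo_plus; [exact Hf|apply holo_opp, Hg]. Qed.

Lemma holo_inv (n : nat) : forall f, holo n f ->
  (forall z, in_disk z -> f z <> 0) -> holo n (fun z => / f z).
Proof.
  induction n as [|n IH]; intros f Hf H0; [exact I|].
  assert (Hf0 := holo_pred _ _ Hf).
  destruct Hf as [f' [Hf Hf']].
  exists (fun z => f' z * (- / f z * / f z)). split.
  - intros z Hz. apply is_derive_Cinv; auto.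
  - apply holo_mult; [exact Hf'|]. apply holo_mult; [apply holo_opp|]; apply IH; assumption.
Qed.

Lemma in_disk_0 : in_disk 0.
Proof. unfold in_disk. rewrite Cmod_0. lra. Qed.

Lemma in_disk_opp (z : C) : in_disk z -> in_disk (- z).
Proof. unfold in_disk. rewrite Cmod_opp. auto. Qed.

Lemma holo_reflect (n : nat) : forall f, holo n f -> holo n (fun z => f (- z)).
Proof.
  induction n as [|n IH]; intros f Hf; [exact I|].
  destruct Hf as [f' [Hf Hf']].
  exists (fun z => - (RtoC 1) * f' (- z)). split.
  - intros z Hz. apply (is_derive_Ccomp f (fun z => - z)).
    + apply Hf, in_disk_opp, Hz.
    + exact (is_derive_opp (fun w : C => w) z (RtoC 1) (is_derive_Cid z)).
  - apply holo_mult; [apply holo_const|]. apply (IH f'), Hf'.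
Qed.

Lemma holo_pow (n k : nat) (f : C -> C) : holo n f -> holo n (fun z => f z ^ k).
Proof.
  intros Hf. induction k as [|k IH]; [exact (holo_const n 1)|].
  exact (holo_mult n f (fun z => f z ^ k) Hf IH).
Qed.

Lemma holo_continuous (f : C -> C) (z : C) : holo 1 f -> in_disk z ->
  forall eps : R, (0 < eps)%R -> exists delta : R, (0 < delta)%R /\
    forall w : C, (Cmod (w - z) < delta)%R -> (Cmod (f w - f z) < eps)%R.
Proof.
  intros [f' [Hf _]] Hz. exact (is_derive_continuous f z (f' z) (Hf z Hz)).
Qed.

(** * The maximum principle *)

(** If [s] exceeds the modulus of [p], the left-hand side is at most zero. *)
Lemma Cmod_sqr_perturb (p w : C) (s : R) :
  (Cmod (w - p) <= s)%R -> (Cmod p ^ 2 - 2 * Cmod p * s <= Cmod w ^ 2)%R.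
Proof.
  intros H. generalize (Cmod_triangle_rev p w). rewrite Cmod_sub_sym. intros H1.
  generalize (Cmod_ge_0 p) (Cmod_ge_0 w) (Cmod_ge_0 (w - p)); intros.
  destruct (Rle_lt_dec s (Cmod p)); nra.
Qed.

(** Averaging over [h], [-h], [i h], [-i h] kills all mixed terms of a quadratic
    polynomial, as these four numbers and their squares sum to zero: this is the
    discrete mean value property behind the maximum principle. *)
Lemma four_point_identity (a b d : C) (t : R) :
  let P h := a + h * b + h * h * d in
  let T := RtoC t in
  (Cmod (P T) ^ 2 + Cmod (P (- T)%C) ^ 2 + Cmod (P (Ci * T)%C) ^ 2 + Cmod (P (- (Ci * T))%C) ^ 2
   = 4 * (Cmod a ^ 2 + t ^ 2 * Cmod b ^ 2 + t ^ 4 * Cmod d ^ 2))%R.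
Proof.
  intros P T. rewrite !Cmod2_alt. unfold P, T.
  destruct a as [a1 a2], b as [b1 b2], d as [d1 d2]. simpl. ring.
Qed.

(** The term [e |z|^2] makes the function strictly subharmonic: its average over the
    four points at distance [t] exceeds the central value by at least [e t^2], up to the
    second order Taylor error, which is a smaller multiple of [t^2]. *)
Lemma no_local_max (f : C -> C) (e : R) (z : C) (r : R) :
  holo 2 f -> (0 < e)%R -> in_disk z -> (0 < r)%R ->
  exists w, (Cmod (w - z) < r)%R /\
    (Cmod (f z) ^ 2 + e * Cmod z ^ 2 < Cmod (f w) ^ 2 + e * Cmod w ^ 2)%R.
Proof.
  intros [f' [Hf [f'' [Hf' _]]]] He Hz Hr. unfold in_disk in Hz.
  set (a := f z). set (b := f' z). set (d := f'' z / 2).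
  set (K := (Cmod a + Cmod b + Cmod d)%R).
  assert (HK : (0 <= K)%R) by (generalize (Cmod_ge_0 a) (Cmod_ge_0 b) (Cmod_ge_0 d); unfold K; lra).
  (* K bounds the Taylor polynomial on the unit disk; eta is chosen so that the Taylor
     error eta t^2 changes each squared modulus by less than e t^2 *)
  set (eta := (e / (2 * K + 1) / 2)%R).
  assert (Heta : (0 < eta)%R) by (unfold eta; repeat apply Rdiv_lt_0_compat; lra).
  assert (HKe : (2 * K * eta < e)%R).
  { assert (H : ((2 * K + 1) * eta = e / 2)%R) by (unfold eta; field; lra). lra. }
  destruct (taylor_second_order f f' z (f'' z) (1 - Cmod z)) with (eps := eta)
    as [dl [Hdl HT]]; try lra.
  { intros w Hw. apply Hf. unfold in_disk.
    generalize (Cmod_triangle_rev w z). lra. }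
  { apply Hf', Hz. }
  fold a b d in HT.
  set (t := (Rmin (Rmin dl r) 1 / 2)%R).
  assert (Ht : (0 < t < dl /\ t < r /\ t < 1)%R).
  { generalize (Rmin_l (Rmin dl r) 1) (Rmin_r (Rmin dl r) 1) (Rmin_l dl r) (Rmin_r dl r).
    assert (0 < Rmin (Rmin dl r) 1)%R by (repeat apply Rmin_glb_lt; lra).
    unfold t. lra. }
  set (T := RtoC t).
  assert (HmT : Cmod T = t) by (unfold T; rewrite Cmod_R, Rabs_pos_eq; lra).
  set (P := fun h : C => a + h * b + h * h * d).
  assert (Hpt : forall h, Cmod h = t ->
    (Cmod (f (z + h)%C) ^ 2 + e * Cmod (z + h)%C ^ 2 <= Cmod a ^ 2 + e * Cmod z ^ 2)%R ->
    (Cmod (P h) ^ 2 - 2 * K * (eta * t ^ 2) + e * Cmod (z + h)%C ^ 2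
      <= Cmod a ^ 2 + e * Cmod z ^ 2)%R).
  { intros h Hh Hle.
    assert (H1 := HT h ltac:(lra)). fold (P h) in H1. rewrite Hh in H1.
    apply Cmod_sqr_perturb in H1.
    assert (HPK : (Cmod (P h) <= K)%R).
    { unfold P, K. apply Rle_trans with (1 := Cmod_triangle _ _).
      apply Rplus_le_compat.
      - apply Rle_trans with (1 := Cmod_triangle _ _).
        rewrite Cmod_mult, Hh. generalize (Cmod_ge_0 b). intros. nra.
      - rewrite !Cmod_mult, Hh. generalize (Cmod_ge_0 d). assert (t * t <= 1)%R by nra. intros. nra. }
    assert (0 <= eta * t ^ 2)%R by nra.
    nra. }
  apply NNPP. intros Hno.
  assert (Hall : forall h, Cmod h = t ->
    (Cmod (f (z + h)%C) ^ 2 + e * Cmod (z + h)%C ^ 2 <= Cmod a ^ 2 + e * Cmod z ^ 2)%R).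
  { intros h Hh. apply Rnot_lt_le. intros Hlt. apply Hno. exists (z + h). split; [|exact Hlt].
    replace (z + h - z) with h by ring. lra. }
  assert (E1 : Cmod (- T) = t) by (rewrite Cmod_opp; exact HmT).
  assert (E2 : Cmod (Ci * T) = t) by (rewrite Cmod_mult, Cmod_Ci, HmT; lra).
  assert (E3 : Cmod (- (Ci * T)) = t) by (rewrite Cmod_opp; exact E2).
  assert (F0 := Hpt _ HmT (Hall _ HmT)). assert (F1 := Hpt _ E1 (Hall _ E1)).
  assert (F2 := Hpt _ E2 (Hall _ E2)). assert (F3 := Hpt _ E3 (Hall _ E3)).
  assert (Q := four_point_identity a b d t). cbv zeta beta in Q. fold T in Q.
  assert (Q' := four_point_identity z 1 0 t). cbv zeta beta in Q'. fold T in Q'.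
  replace (z + T * 1 + T * T * 0) with (z + T) in Q' by ring.
  replace (z + - T * 1 + - T * - T * 0) with (z + - T) in Q' by ring.
  replace (z + Ci * T * 1 + Ci * T * (Ci * T) * 0) with (z + Ci * T) in Q' by ring.
  replace (z + - (Ci * T) * 1 + - (Ci * T) * - (Ci * T) * 0) with (z + - (Ci * T)) in Q' by ring.
  rewrite Cmod_1, Cmod_0 in Q'.
  unfold P in F0, F1, F2, F3.
  generalize (pow2_ge_0 (Cmod b)) (pow2_ge_0 (Cmod d)); intros Hb Hd.
  assert (Ht2 : (0 < t ^ 2)%R) by nra.
  assert (Ht4 : (0 <= t ^ 4)%R) by (apply pow_le; lra).
  assert (0 <= t ^ 2 * Cmod b ^ 2)%R by nra.
  assert (0 <= t ^ 4 * Cmod d ^ 2)%R by nra.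
  assert (Q2 := f_equal (Rmult e) Q').
  assert (HKt : (2 * K * eta * t ^ 2 < e * t ^ 2)%R) by (apply Rmult_lt_compat_r; assumption).
  lra.
Qed.

(** The boundary condition is a limit superior because [f] need not extend to the
    closed disk. A value of modulus above [L] inside would give [|f|^2 + d^2 |z|^2] an
    interior maximum on a slightly smaller closed disk. *)
Lemma maximum_principle (f : C -> C) (L : R) :
  holo 2 f -> (0 <= L)%R ->
  (forall eps : R, (0 < eps)%R -> exists rho : R, (rho < 1)%R /\
     forall z, (rho <= Cmod z < 1)%R -> (Cmod (f z) <= L + eps)%R) ->
  forall z, in_disk z -> (Cmod (f z) <= L)%R.
Proof.
  intros Hf HL Hb a Ha. unfold in_disk in Ha. apply Rnot_lt_le. intros Hlt.
  set (d := ((Cmod (f a) - L) / 2)%R).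
  assert (Hd : (0 < d)%R) by (unfold d; lra).
  destruct (Hb d Hd) as [rho0 [Hr0 Hbr]].
  set (rho := Rmax rho0 ((1 + Cmod a) / 2)).
  assert (Hrho : (rho0 <= rho /\ (1 + Cmod a) / 2 <= rho < 1)%R).
  { unfold rho. split; [apply Rmax_l|split; [apply Rmax_r|]]. apply Rmax_lub_lt; lra. }
  generalize (Cmod_ge_0 a); intros Ha0.
  set (u := fun z => (Cmod (f z) ^ 2 + d ^ 2 * Cmod z ^ 2)%R).
  assert (Hd2 : (0 < d ^ 2)%R) by nra.
  destruct (closed_disk_max u rho) as [z0 [Hz0 Hmax]]; [lra| |].
  - intros z Hz eps Heps.
    assert (Hcont : exists d1, (0 < d1)%R /\ forall w, (Cmod (w - z) < d1)%R ->
      (Rabs (Cmod (f w) ^ 2 - Cmod (f z) ^ 2) < eps / 2)%R).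
    { set (e1 := Rmin 1 (eps / 2 / (2 * Cmod (f z) + 2))).
      assert (Hfz := Cmod_ge_0 (f z)).
      assert (He1 : (0 < e1)%R) by (apply Rmin_glb_lt; [lra|apply Rdiv_lt_0_compat; lra]).
      destruct (holo_continuous f z (holo_pred _ _ Hf) ltac:(unfold in_disk; lra) e1 He1)
        as [d1 [Hd1 Hw]].
      exists d1. split; [exact Hd1|]. intros w Hwz. specialize (Hw w Hwz).
      assert (Hq : (e1 * (2 * Cmod (f z) + 2) <= eps / 2)%R).
      { apply Rle_trans with (eps / 2 / (2 * Cmod (f z) + 2) * (2 * Cmod (f z) + 2))%R.
        - apply Rmult_le_compat_r; [lra|apply Rmin_r].
        - right. field. lra. }
      assert (He1' := Rmin_l 1 (eps / 2 / (2 * Cmod (f z) + 2))). fold e1 in He1'.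
      assert (T1 := Cmod_triangle_rev (f w) (f z)).
      assert (T2 := Cmod_triangle_rev (f z) (f w)). rewrite Cmod_sub_sym in T2.
      generalize (Cmod_ge_0 (f w)); intros Hfw.
      apply Rabs_def1; nra. }
    destruct Hcont as [d1 [Hd1 Hw1]].
    generalize (Cmod_ge_0 z); intros Hz1.
    exists (Rmin d1 (Rmin 1 (eps / 2 / (d ^ 2 * 4)))). split.
    { repeat apply Rmin_glb_lt; try lra. repeat apply Rdiv_lt_0_compat; lra. }
    intros w _ Hw.
    generalize (Rmin_l d1 (Rmin 1 (eps / 2 / (d ^ 2 * 4)))) (Rmin_r d1 (Rmin 1 (eps / 2 / (d ^ 2 * 4))))
      (Rmin_l 1 (eps / 2 / (d ^ 2 * 4))) (Rmin_r 1 (eps / 2 / (d ^ 2 * 4))); intros M1 M2 M3 M4.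
    specialize (Hw1 w ltac:(lra)).
    assert (Hq : (Cmod (w - z) * (d ^ 2 * 4) < eps / 2)%R).
    { apply Rlt_le_trans with (eps / 2 / (d ^ 2 * 4) * (d ^ 2 * 4))%R.
      - apply Rmult_lt_compat_r; lra.
      - right. field. nra. }
    assert (T1 := Cmod_triangle_rev w z).
    assert (T2 := Cmod_triangle_rev z w). rewrite Cmod_sub_sym in T2.
    generalize (Cmod_ge_0 w) (Cmod_ge_0 (w - z)); intros Hw0 Hwz0.
    assert (Hsq : (Rabs (d ^ 2 * Cmod w ^ 2 - d ^ 2 * Cmod z ^ 2) < eps / 2)%R).
    { replace (d ^ 2 * Cmod w ^ 2 - d ^ 2 * Cmod z ^ 2)%R
        with (d ^ 2 * ((Cmod w - Cmod z) * (Cmod w + Cmod z)))%R by ring.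
      rewrite !Rabs_mult, (Rabs_pos_eq (d ^ 2)), (Rabs_pos_eq (Cmod w + Cmod z)) by lra.
      apply Rle_lt_trans with (2 := Hq).
      assert (Rabs (Cmod w - Cmod z) <= Cmod (w - z))%R by (apply Rabs_le; lra).
      assert (Cmod w + Cmod z <= 4)%R by lra.
      generalize (Rabs_pos (Cmod w - Cmod z)); intros Hpos.
      rewrite (Rmult_comm _ (d ^ 2 * 4)), Rmult_assoc. apply Rmult_le_compat_l; [lra|]. nra. }
    unfold u.
    replace (Cmod (f w) ^ 2 + d ^ 2 * Cmod w ^ 2 - (Cmod (f z) ^ 2 + d ^ 2 * Cmod z ^ 2))%R
      with ((Cmod (f w) ^ 2 - Cmod (f z) ^ 2) + (d ^ 2 * Cmod w ^ 2 - d ^ 2 * Cmod z ^ 2))%R by ring.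
    apply Rle_lt_trans with (1 := Rabs_triang _ _). lra.
  - destruct (Rle_lt_or_eq_dec _ _ Hz0) as [Hin|Hbd].
    + destruct (no_local_max f (d ^ 2) z0 (rho - Cmod z0) Hf Hd2) as [w [Hw1 Hw2]].
      * unfold in_disk. lra.
      * lra.
      * apply (Rlt_irrefl (u w)). apply Rle_lt_trans with (u z0); [|exact Hw2].
        apply Hmax. generalize (Cmod_triangle_rev w z0). lra.
    + assert (H1 := Hmax a ltac:(lra)). unfold u in H1.
      assert (H2 := Hbr z0 ltac:(lra)).
      assert (Hfa : Cmod (f a) = (L + 2 * d)%R) by (unfold d; field).
      rewrite Hfa in H1. rewrite Hbd in H1.
      generalize (Cmod_ge_0 (f z0)) (Cmod_ge_0 a); intros Hp1 Hp2.
      assert (H3 : (Cmod (f z0) ^ 2 <= (L + d) ^ 2)%R) by nra.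
      assert (Hr2 : (rho ^ 2 <= 1)%R) by nra.
      assert (H4 : (d ^ 2 * rho ^ 2 <= d ^ 2 * 1)%R) by (apply Rmult_le_compat_l; lra).
      assert (H5 : (0 <= d ^ 2 * Cmod a ^ 2)%R) by nra.
      nra.
Qed.

(** * Schwarz and Schwarz-Pick bounds *)

Lemma bernoulli_sub (x : R) (n : nat) : (0 <= x <= 1)%R -> (1 - INR n * x <= (1 - x) ^ n)%R.
Proof.
  intros Hx. induction n as [|n IH]; [simpl; lra|].
  rewrite S_INR. simpl.
  assert (0 <= (1 - x) ^ n)%R by (apply pow_le; lra).
  assert ((1 - x) ^ n <= 1)%R by (rewrite <- (pow1 n) at 2; apply pow_incr; lra).
  nra.
Qed.

(** Schwarz's lemma with the factor [z^n] already divided out: on circles of radius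
    tending to one the factor disappears, and the maximum principle does the rest. *)
Lemma schwarz_pow (f : C -> C) (n : nat) :
  holo 2 f -> (forall z, in_disk z -> (Cmod (z ^ n * f z) <= 1)%R) ->
  forall z, in_disk z -> (Cmod (f z) <= 1)%R.
Proof.
  intros Hf Hb. apply maximum_principle; [exact Hf|lra|].
  intros eps Heps.
  set (N := (INR n + 1)%R).
  assert (HN : (1 <= N)%R) by (generalize (pos_INR n); unfold N; lra).
  (* chosen so that (1 - N x) (1 + eps) = 1; N exceeds n so that n = 0 is covered *)
  set (x := (eps / (N * (1 + eps)))%R).
  assert (Hxe : (x * N * (1 + eps) = eps)%R) by (unfold x; field; lra).
  assert (Hx : (0 < x <= 1)%R).
  { split; [apply Rdiv_lt_0_compat; nra|]. apply Rnot_lt_le. intros Hlt.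
    assert (x <= x * N)%R by nra. nra. }
  exists (1 - x)%R. split; [lra|]. intros z Hz.
  assert (H1 := Hb z (proj2 Hz)). rewrite Cmod_mult, Cmod_pow in H1.
  assert (H2 : ((1 - x) ^ n <= Cmod z ^ n)%R) by (apply pow_incr; lra).
  assert (H3 := bernoulli_sub x n ltac:(lra)).
  assert (Hnx : (INR n * x <= x * N)%R) by (unfold N; lra).
  assert (H4 : (1 <= Cmod z ^ n * (1 + eps))%R).
  { apply Rle_trans with ((1 - x * N) * (1 + eps))%R; [lra|].
    apply Rmult_le_compat_r; lra. }
  generalize (Cmod_ge_0 (f z)); intros Hp.
  assert (Hzn : (0 < Cmod z ^ n)%R).
  { apply Rnot_le_lt. intros Hle. nra. }
  apply Rmult_le_reg_l with (Cmod z ^ n)%R; [exact Hzn|]. lra.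
Qed.

(** The difference of the squares is [(1 - |x|^2) (1 - |y|^2)]. *)
Lemma moebius_le (x y : C) :
  (Cmod x <= 1)%R -> (Cmod y <= 1)%R -> (Cmod (x - y) <= Cmod (1 - Cconj y * x))%R.
Proof.
  intros Hx Hy.
  apply Rsqr_incr_0; try apply Cmod_ge_0. rewrite !Rsqr_pow2.
  assert (Hx2 : (Cmod x ^ 2 <= 1)%R) by (generalize (Cmod_ge_0 x); nra).
  assert (Hy2 : (Cmod y ^ 2 <= 1)%R) by (generalize (Cmod_ge_0 y); nra).
  assert (H : (Cmod (1 - Cconj y * x) ^ 2 - Cmod (x - y) ^ 2
               = (1 - Cmod x ^ 2) * (1 - Cmod y ^ 2))%R).
  { rewrite !Cmod2_alt. destruct x, y. simpl. ring. }
  nra.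
Qed.

(** The function [g = d + z^n h] maps the disk to the closed disk. A Moebius map sending
    [d] to [0] turns it into [z^n h / (1 - conj d * g)], to which Schwarz's lemma applies;
    evaluate at [0]. *)
Lemma schwarz_pick_coefficient (h : C -> C) (d : C) (n : nat) :
  holo 2 h -> (0 < n)%nat ->
  (forall z, in_disk z -> (Cmod (d + z ^ n * h z) <= 1)%R) ->
  (Cmod (h 0) <= 1 - Cmod d ^ 2)%R.
Proof.
  intros Hh Hn Hb.
  assert (H0 : in_disk 0) by (unfold in_disk; rewrite Cmod_0; lra).
  assert (H0n : RtoC 0 ^ n = 0) by (destruct n; [lia|simpl; ring]).
  assert (Hd : (Cmod d <= 1)%R).
  { generalize (Hb 0 H0). rewrite H0n. replace (d + 0 * h 0) with d by ring. auto. }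
  (* replacing g by s g keeps the Moebius denominator away from zero, even for |d| = 1 *)
  assert (Hs : forall s : R, (0 <= s < 1)%R -> (s * Cmod (h 0) <= 1 - s ^ 2 * Cmod d ^ 2)%R).
  { intros s Hs.
    set (den := fun z => 1 - RtoC (s ^ 2) * Cconj d * (d + z ^ n * h z)).
    assert (Hden : forall z, in_disk z -> den z <> 0).
    { intros z Hz Heq. assert (Hbz := Hb z Hz).
      assert (H1 : RtoC (s ^ 2) * Cconj d * (d + z ^ n * h z) = 1).
      { replace (RtoC 1) with (den z + RtoC (s ^ 2) * Cconj d * (d + z ^ n * h z))
          by (unfold den; ring).
        rewrite Heq. ring. }
      apply (f_equal Cmod) in H1.
      rewrite Cmod_1, !Cmod_mult, Cmod_conj, Cmod_R, Rabs_pos_eq in H1 by nra.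
      generalize (Cmod_ge_0 d) (Cmod_ge_0 (d + z ^ n * h z)); intros P1 P2.
      assert (Cmod d * Cmod (d + z ^ n * h z) <= 1)%R by nra.
      assert (s ^ 2 < 1)%R by nra.
      nra. }
    assert (H2 := schwarz_pow (fun z => RtoC s * h z * / den z) n).
    assert (Hq : (Cmod (RtoC s * h 0 * / den 0) <= 1)%R).
    { apply H2; [| |exact H0].
      - apply holo_mult; [apply holo_mult; [apply holo_const|exact Hh]|].
        apply holo_inv; [|exact Hden]. unfold den.
        apply holo_minus; [apply holo_const|].
        apply holo_mult; [apply holo_const|].
        apply holo_plus; [apply holo_const|].
        apply holo_mult; [|exact Hh]. apply holo_pow, holo_id.
      - intros z Hz. assert (Hdz := Hden z Hz).
        replace (z ^ n * (RtoC s * h z * / den z))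
          with ((RtoC s * (d + z ^ n * h z) - RtoC s * d) / den z) by (field; exact Hdz).
        rewrite Cmod_div by exact Hdz.
        assert (Hpos := proj1 (Cmod_gt_0 _) Hdz).
        apply Rmult_le_reg_r with (Cmod (den z)); [exact Hpos|].
        unfold Rdiv. rewrite Rmult_assoc, Rinv_l, Rmult_1_r, Rmult_1_l by lra.
        assert (Hbz := Hb z Hz).
        replace (den z) with (1 - Cconj (RtoC s * d) * (RtoC s * (d + z ^ n * h z))).
        2:{ unfold den. rewrite Cmult_conj, RtoC_pow.
            replace (Cconj (RtoC s)) with (RtoC s) by (unfold Cconj, RtoC; simpl; f_equal; ring).
            ring. }
        apply moebius_le; rewrite Cmod_mult, Cmod_R, Rabs_pos_eq by lra.
        + generalize (Cmod_ge_0 (d + z ^ n * h z)). nra.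
        + generalize (Cmod_ge_0 d). nra. }
    assert (Hd0 : den 0 = RtoC (1 - s ^ 2 * Cmod d ^ 2)).
    { unfold den. rewrite H0n. rewrite RtoC_minus, RtoC_mult, Cmod2_conj. ring. }
    assert (Hpos : (0 < 1 - s ^ 2 * Cmod d ^ 2)%R).
    { generalize (Cmod_ge_0 d); intros. assert (Cmod d ^ 2 <= 1)%R by nra.
      assert (s ^ 2 < 1)%R by nra. nra. }
    assert (Hdm : Cmod (den 0) = (1 - s ^ 2 * Cmod d ^ 2)%R).
    { rewrite Hd0, Cmod_R, Rabs_pos_eq; lra. }
    rewrite !Cmod_mult, Cmod_inv, Hdm, Cmod_R, Rabs_pos_eq in Hq by (try apply Hden; auto; lra).
    apply Rmult_le_reg_r with (/ (1 - s ^ 2 * Cmod d ^ 2))%R; [apply Rinv_0_lt_compat, Hpos|].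
    rewrite Rinv_r by lra. exact Hq. }
  generalize (Cmod_ge_0 d) (Cmod_ge_0 (h 0)); intros Hd0 Hh0.
  apply Rnot_lt_le. intros Hlt.
  set (X := Cmod (h 0)) in *. set (Y := Cmod d) in *.
  set (g := (X - (1 - Y ^ 2))%R). assert (Hg : (0 < g)%R) by (unfold g; lra).
  set (t := Rmin 1 (g / (2 * (X + 2)))).
  assert (Ht : (0 < t <= 1)%R).
  { split; [apply Rmin_glb_lt; [lra|apply Rdiv_lt_0_compat; lra]|apply Rmin_l]. }
  assert (Ht2 : (t * (X + 2) <= g / 2)%R).
  { apply Rle_trans with (g / (2 * (X + 2)) * (X + 2))%R.
    - apply Rmult_le_compat_r; [lra|apply Rmin_r].
    - right. field. lra. }
  assert (Hst := Hs (1 - t)%R ltac:(lra)).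
  assert (Y ^ 2 <= 1)%R by nra.
  assert (t * Y ^ 2 <= t)%R by nra.
  assert (0 <= t ^ 2 * Y ^ 2)%R by nra.
  unfold g in *. nra.
Qed.

(** * Power series *)

Lemma is_series_C_iff (a : nat -> C) (l : C) :
  is_series a l <->
  forall eps : R, (0 < eps)%R -> exists N : nat, forall n, (N <= n)%nat ->
    (Cmod (sum_n a n - l) < eps)%R.
Proof.
  unfold is_series. split.
  - intros H eps Heps.
    destruct (proj1 (filterlim_locally_ball_norm _ _) H (mkposreal eps Heps)) as [N HN].
    exists N. intros n Hn. exact (HN n Hn).
  - intros H. apply (filterlim_locally_ball_norm (U := C_NormedModule)). intros eps.
    destruct (H eps (cond_pos eps)) as [N HN]. exists N. intros n Hn. exact (HN n Hn).
Qed.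

Lemma is_series_C_unique (a : nat -> C) (l m : C) : is_series a l -> is_series a m -> l = m.
Proof. intros H1 H2. exact (filterlim_locally_unique _ _ _ H1 H2). Qed.

Lemma is_series_C_ext (a b : nat -> C) (l m : C) :
  (forall n, a n = b n) -> l = m -> is_series a l -> is_series b m.
Proof. intros Hab <-. apply is_series_ext, Hab. Qed.

Lemma is_series_C_zero : is_series (fun _ : nat => RtoC 0) (RtoC 0).
Proof.
  apply is_series_C_iff. intros eps Heps. exists 0%nat. intros n _.
  replace (sum_n (fun _ => RtoC 0) n) with (RtoC 0).
  - replace (0 - 0) with (RtoC 0) by ring. rewrite Cmod_0. exact Heps.
  - symmetry. induction n as [|n IH]; [apply sum_O|].
    rewrite sum_Sn, IH. change (0 + 0 = 0). ring.
Qed.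

Lemma is_pseries_C_iff (a : nat -> C) (z l : C) :
  is_pseries a z l <-> is_series (fun n => z ^ n * a n) l.
Proof.
  unfold is_pseries. split; apply is_series_ext; intros n; reflexivity.
Qed.

Lemma Cmod_series_le (a : nat -> C) (b : nat -> R) (l : C) (s : R) :
  is_series a l -> is_series b s -> (forall n, (Cmod (a n) <= b n)%R) -> (Cmod l <= s)%R.
Proof.
  intros Ha Hb Hab.
  assert (Hpart : forall n, (Cmod (sum_n a n) <= s)%R).
  { intros n.
    apply Rle_trans with (sum_n b n).
    - apply Rle_trans with (sum_n (fun k => Cmod (a k)) n).
      + exact (norm_sum_n_m (V := C_NormedModule) a 0 n).
      + apply sum_n_m_le, Hab.
    - apply is_series_Reals in Hb.
      rewrite sum_n_Reals. apply sum_incr; [exact Hb|].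
      intros k. apply Rle_trans with (2 := Hab k). apply Cmod_ge_0. }
  apply Rnot_lt_le. intros Hlt.
  destruct (proj1 (is_series_C_iff a l) Ha (Cmod l - s)%R ltac:(lra)) as [N HN].
  specialize (HN N (Nat.le_refl N)). specialize (Hpart N).
  generalize (Cmod_triangle_rev l (sum_n a N)). rewrite Cmod_sub_sym. lra.
Qed.

(** This is equivalent to convergence on the open disk, but passes at once to shifted
    coefficients and to products with [n]. *)
Definition disk_bounded (a : nat -> C) : Prop :=
  forall rho : R, (0 < rho < 1)%R -> exists M : R, forall n, (Cmod (a n) * rho ^ n <= M)%R.

Lemma disk_bounded_of_taylor (f : C -> C) (a : nat -> C) :
  taylor_expansion f a -> disk_bounded a.
Proof.
  intros H rho Hrho.
  assert (Hd : in_disk (RtoC rho)) by (unfold in_disk; rewrite Cmod_R, Rabs_pos_eq; lra).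
  destruct (proj1 (is_series_C_iff _ _) (proj1 (is_pseries_C_iff _ _ _) (H _ Hd)) 1%R Rlt_0_1)
    as [N HN].
  set (u := fun n => RtoC rho ^ n * a n) in *.
  assert (HuN : forall n, (Cmod (a n) * rho ^ n)%R = Cmod (u n)).
  { intros n. unfold u. rewrite Cmod_mult, Cmod_pow, Cmod_R, Rabs_pos_eq by lra. ring. }
  assert (Hfin : forall K : nat, exists M, forall n, (n < K)%nat -> (Cmod (u n) <= M)%R).
  { induction K as [|K [M HM]]; [exists 0%R; intros; lia|].
    exists (Rmax M (Cmod (u K))). intros n Hn.
    destruct (Nat.eq_dec n K) as [->|Hne]; [apply Rmax_r|].
    apply Rle_trans with (2 := Rmax_l _ _). apply HM. lia. }
  destruct (Hfin (S N)) as [M HM].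
  exists (Rmax M 2). intros n. rewrite HuN.
  destruct (Nat.lt_ge_cases n (S N)) as [Hlt|Hge].
  - apply Rle_trans with (2 := Rmax_l _ _). auto.
  - apply Rle_trans with (2 := Rmax_r _ _).
    destruct n as [|n]; [lia|].
    assert (H1 := HN n ltac:(lia)). assert (H2 := HN (S n) ltac:(lia)).
    rewrite sum_Sn in H2.
    set (S0 := sum_n u n) in *.
    replace (u (S n)) with ((plus S0 (u (S n)) - f (RtoC rho)) - (S0 - f (RtoC rho))).
    2:{ change (plus S0 (u (S n))) with (S0 + u (S n)). ring. }
    apply Rle_trans with (1 := Cmod_triangle_sub _ _). lra.
Qed.

Lemma disk_bounded_shift (a : nat -> C) :
  disk_bounded a -> disk_bounded (fun n => a (S n)).
Proof.
  intros H rho Hrho. destruct (H rho Hrho) as [M HM].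
  exists (M / rho)%R. intros n. specialize (HM (S n)). simpl in HM.
  apply Rmult_le_reg_r with rho; [lra|].
  unfold Rdiv. rewrite (Rmult_assoc M), Rinv_l by lra. lra.
Qed.

Lemma nat_times_pow_bounded (t : R) : (0 < t < 1)%R ->
  exists B, forall n, (INR n * t ^ n <= B)%R.
Proof.
  intros Ht. exists (/ (/ t - 1))%R. intros n.
  assert (Hit : (1 < / t)%R) by (rewrite <- Rinv_1; apply Rinv_lt_contravar; lra).
  assert (H := poly n (/ t - 1) ltac:(lra)).
  replace (1 + (/ t - 1))%R with (/ t)%R in H by ring.
  rewrite pow_inv in H.
  assert (Htn : (0 < t ^ n)%R) by (apply pow_lt; lra).
  apply Rmult_le_reg_r with (/ t - 1)%R; [lra|]. rewrite Rinv_l by lra.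
  apply (Rmult_le_compat_r (t ^ n)) in H; [|lra]. rewrite Rinv_l in H by lra. nra.
Qed.

Lemma disk_bounded_mult_nat (a : nat -> C) :
  disk_bounded a -> disk_bounded (fun n => RtoC (INR n) * a n).
Proof.
  intros H rho Hrho. set (r := ((1 + rho) / 2)%R).
  assert (Hr : (rho < r < 1)%R) by (unfold r; lra).
  destruct (H r ltac:(lra)) as [M HM].
  assert (Hq : (0 < rho / r < 1)%R).
  { split; [apply Rdiv_lt_0_compat; lra|].
    apply Rmult_lt_reg_r with r; [lra|]. unfold Rdiv. rewrite Rmult_assoc, Rinv_l; lra. }
  destruct (nat_times_pow_bounded (rho / r) Hq) as [B HB].
  exists (M * B)%R. intros n.
  rewrite Cmod_mult, Cmod_R, Rabs_pos_eq by apply pos_INR.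
  replace (rho ^ n)%R with (r ^ n * (rho / r) ^ n)%R.
  2:{ rewrite <- Rpow_mult_distr. f_equal. field. lra. }
  replace (INR n * Cmod (a n) * (r ^ n * (rho / r) ^ n))%R
    with ((Cmod (a n) * r ^ n) * (INR n * (rho / r) ^ n))%R by ring.
  assert (0 <= Cmod (a n) * r ^ n)%R by (apply Rmult_le_pos; [apply Cmod_ge_0|apply pow_le; lra]).
  assert (0 <= INR n * (rho / r) ^ n)%R by (apply Rmult_le_pos; [apply pos_INR|apply pow_le; lra]).
  apply Rmult_le_compat; auto.
Qed.

Lemma disk_bounded_summable (a : nat -> C) (rho : R) :
  disk_bounded a -> (0 < rho < 1)%R -> ex_series (fun n => (Cmod (a n) * rho ^ n)%R).
Proof.
  intros H Hrho. set (r := ((1 + rho) / 2)%R).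
  assert (Hr : (rho < r < 1)%R) by (unfold r; lra).
  destruct (H r ltac:(lra)) as [M HM].
  assert (Hq : (0 < rho / r < 1)%R).
  { split; [apply Rdiv_lt_0_compat; lra|].
    apply Rmult_lt_reg_r with r; [lra|]. unfold Rdiv. rewrite Rmult_assoc, Rinv_l; lra. }
  apply (ex_series_le (V := R_CompleteNormedModule) _ (fun n => (M * (rho / r) ^ n)%R)).
  - intros n. change (norm (Cmod (a n) * rho ^ n)%R) with (Rabs (Cmod (a n) * rho ^ n)).
    rewrite Rabs_pos_eq by (apply Rmult_le_pos; [apply Cmod_ge_0|apply pow_le; lra]).
    replace (rho ^ n)%R with (r ^ n * (rho / r) ^ n)%R.
    2:{ rewrite <- Rpow_mult_distr. f_equal. field. lra. }
    rewrite <- Rmult_assoc. apply Rmult_le_compat_r; [apply pow_le; lra|apply HM].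
  - apply (ex_series_scal_l (V := R_NormedModule) M). apply ex_series_geom.
    rewrite Rabs_pos_eq; lra.
Qed.

Definition psum (a : nat -> C) (z : C) : C :=
  epsilon (inhabits (RtoC 0)) (is_pseries a z).

Lemma psum_correct (a : nat -> C) (z : C) :
  disk_bounded a -> in_disk z -> is_pseries a z (psum a z).
Proof.
  intros H Hz. unfold psum. apply epsilon_spec.
  unfold in_disk in Hz. set (rho := ((1 + Cmod z) / 2)%R).
  assert (Hrho : (0 < rho < 1 /\ Cmod z <= rho)%R)
    by (generalize (Cmod_ge_0 z); unfold rho; lra).
  destruct (ex_series_le (V := C_CompleteNormedModule) (fun n => z ^ n * a n)
    (fun n => (Cmod (a n) * rho ^ n)%R)) as [l Hl].
  - intros n. change (norm (z ^ n * a n)) with (Cmod (z ^ n * a n)).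
    rewrite Cmod_mult, Cmod_pow, Rmult_comm. apply Rmult_le_compat_l; [apply Cmod_ge_0|].
    apply pow_incr. generalize (Cmod_ge_0 z). lra.
  - apply disk_bounded_summable; tauto.
  - exists l. apply is_pseries_C_iff, Hl.
Qed.

Lemma is_pseries_C_unique (a : nat -> C) (z l m : C) :
  is_pseries a z l -> is_pseries a z m -> l = m.
Proof. exact (is_series_C_unique _ l m). Qed.

Lemma psum_shift (a : nat -> C) (z l : C) :
  disk_bounded a -> in_disk z -> is_pseries a z l ->
  l = a 0%nat + z * psum (fun n => a (S n)) z.
Proof.
  intros H Hz Hl. apply (is_pseries_C_unique a z); [exact Hl|].
  apply is_pseries_C_iff. apply is_series_decr_1.
  assert (H1 := psum_correct _ z (disk_bounded_shift a H) Hz).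
  apply is_pseries_C_iff in H1.
  apply (is_series_scal (V := C_NormedModule) z) in H1.
  revert H1. apply is_series_C_ext.
  - intros n. change (z * (z ^ n * a (S n)) = z ^ S n * a (S n)). simpl. ring.
  - change (z * psum (fun n => a (S n)) z
       = a 0%nat + z * psum (fun n => a (S n)) z + - (z ^ 0 * a 0%nat)). simpl. ring.
Qed.

(** The factor [rho^2] on the left compensates for the exponent [n - 1] that the
    natural form of the bound would have. *)
Lemma pow_linearization (rho : R) (z w : C) (n : nat) :
  (0 < rho < 1)%R -> (Cmod z <= rho)%R -> (Cmod w <= rho)%R ->
  (rho ^ 2 * Cmod (w ^ S n - z ^ S n - (w - z) * (RtoC (INR (S n)) * z ^ n))
    <= INR (S n) ^ 2 * rho ^ S n * Cmod (w - z) ^ 2)%R.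
Proof.
  intros Hrho Hz Hw.
  generalize (pow2_ge_0 (Cmod (w - z))); intros Hd.
  induction n as [|n IH].
  - replace (w ^ 1 - z ^ 1 - (w - z) * (RtoC (INR 1) * z ^ 0)) with (RtoC 0) by (simpl; ring).
    rewrite Cmod_0. simpl. nra.
  - replace (w ^ S (S n) - z ^ S (S n) - (w - z) * (RtoC (INR (S (S n))) * z ^ S n))
      with (w * (w ^ S n - z ^ S n - (w - z) * (RtoC (INR (S n)) * z ^ n))
            + RtoC (INR (S n)) * z ^ n * ((w - z) * (w - z))).
    2:{ rewrite (S_INR (S n)), RtoC_plus. simpl (_ ^ S _). ring. }
    set (E := w ^ S n - z ^ S n - (w - z) * (RtoC (INR (S n)) * z ^ n)) in *.
    apply Rle_trans with (rho * (rho ^ 2 * Cmod E)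
       + rho ^ 2 * (INR (S n) * rho ^ n * Cmod (w - z) ^ 2))%R.
    + replace (rho * (rho ^ 2 * Cmod E) + rho ^ 2 * (INR (S n) * rho ^ n * Cmod (w - z) ^ 2))%R
        with (rho ^ 2 * (rho * Cmod E + INR (S n) * rho ^ n * Cmod (w - z) ^ 2))%R by ring.
      apply Rmult_le_compat_l; [nra|].
      apply Rle_trans with (1 := Cmod_triangle _ _).
      rewrite !Cmod_mult, Cmod_pow, Cmod_R, (Rabs_pos_eq _ (pos_INR (S n))).
      apply Rplus_le_compat.
      * apply Rmult_le_compat_r; [apply Cmod_ge_0|exact Hw].
      * replace (Cmod (w - z) * Cmod (w - z))%R with (Cmod (w - z) ^ 2)%R by ring.
        apply Rmult_le_compat_r; [exact Hd|]. apply Rmult_le_compat_l; [apply pos_INR|].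
        apply pow_incr. split; [apply Cmod_ge_0|exact Hz].
    + apply (Rmult_le_compat_l rho) in IH; [|lra].
      apply Rle_trans with (1 := Rplus_le_compat_r _ _ _ IH).
      replace (rho * (INR (S n) ^ 2 * rho ^ S n * Cmod (w - z) ^ 2)
          + rho ^ 2 * (INR (S n) * rho ^ n * Cmod (w - z) ^ 2))%R
        with ((INR (S n) ^ 2 + INR (S n)) * (rho ^ S (S n) * Cmod (w - z) ^ 2))%R
        by (simpl; ring).
      rewrite (Rmult_assoc (INR (S (S n)) ^ 2)).
      apply Rmult_le_compat_r.
      * apply Rmult_le_pos; [apply pow_le; lra|exact Hd].
      * rewrite (S_INR (S n)). generalize (pos_INR (S n)). nra.
Qed.

(** Sum the linearization errors of the monomials: the series of [n^2 |a n| rho^n]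
    converges for [rho] strictly between [|z|] and one. *)
Lemma is_derive_psum (a : nat -> C) (z : C) :
  disk_bounded a -> in_disk z ->
  is_derive (psum a) z (psum (fun n => RtoC (INR (S n)) * a (S n)) z).
Proof.
  intros Ha Hz.
  set (a' := fun n => RtoC (INR (S n)) * a (S n)).
  assert (Ha1 := disk_bounded_shift a Ha).
  assert (Ha' : disk_bounded a') by (exact (disk_bounded_shift _ (disk_bounded_mult_nat a Ha))).
  assert (Ha'' : disk_bounded (fun n => RtoC (INR n) * (RtoC (INR n) * a n)))
    by (apply (disk_bounded_mult_nat (fun n => RtoC (INR n) * a n)), disk_bounded_mult_nat, Ha).
  apply disk_bounded_shift in Ha''.
  unfold in_disk in Hz. set (rho := ((1 + Cmod z) / 2)%R).
  assert (Hrho : (0 < rho < 1 /\ Cmod z < rho)%R)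
    by (generalize (Cmod_ge_0 z); unfold rho; lra).
  destruct Hrho as [Hrho Hzr].
  destruct (disk_bounded_summable _ rho Ha'' Hrho) as [B HB].
  cbv beta in HB.
  assert (HB0 : (0 <= B)%R).
  { apply Rle_trans with (Cmod 0); [rewrite Cmod_0; lra|].
    apply (Cmod_series_le _ _ _ _ is_series_C_zero HB).
    intros n. rewrite Cmod_0. apply Rmult_le_pos; [apply Cmod_ge_0|apply pow_le; lra]. }
  apply is_derive_C_iff. intros eps Heps.
  exists (Rmin (rho - Cmod z) (eps * rho / (B + 1))). split.
  { apply Rmin_glb_lt; [lra|]. apply Rdiv_lt_0_compat; nra. }
  intros w Hw.
  generalize (Rmin_l (rho - Cmod z) (eps * rho / (B + 1)))
    (Rmin_r (rho - Cmod z) (eps * rho / (B + 1))); intros M1 M2.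
  assert (Hwr : (Cmod w < rho)%R) by (generalize (Cmod_triangle_rev w z); lra).
  assert (Hwd : in_disk w) by (unfold in_disk; lra).
  assert (Hzd : in_disk z) by (unfold in_disk; lra).
  set (dd := Cmod (w - z)) in *.
  assert (Hdd : (0 <= dd)%R) by apply Cmod_ge_0.
  assert (Sw := psum_correct (fun n => a (S n)) w Ha1 Hwd).
  assert (Sz := psum_correct (fun n => a (S n)) z Ha1 Hzd).
  assert (Sz' := psum_correct a' z Ha' Hzd).
  rewrite (psum_shift a w _ Ha Hwd (psum_correct a w Ha Hwd)).
  rewrite (psum_shift a z _ Ha Hzd (psum_correct a z Ha Hzd)).
  apply is_pseries_C_iff in Sw, Sz, Sz'.
  apply (is_series_scal (V := C_NormedModule) w) in Sw.
  apply (is_series_scal (V := C_NormedModule) z) in Sz.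
  apply (is_series_scal (V := C_NormedModule) (w - z)) in Sz'.
  assert (St := is_series_minus _ _ _ _ (is_series_minus _ _ _ _ Sw Sz) Sz').
  apply (is_series_scal_l (V := R_NormedModule) (/ rho * dd ^ 2)%R) in HB.
  set (T := plus _ _) in St.
  replace (a 0%nat + w * psum (fun n => a (S n)) w - (a 0%nat + z * psum (fun n => a (S n)) z)
     - (w - z) * psum a' z) with T.
  2:{ unfold T. change (w * psum (fun n => a (S n)) w + - (z * psum (fun n => a (S n)) z)
        + - ((w - z) * psum a' z) = a 0%nat + w * psum (fun n => a (S n)) w - (a 0%nat + z * psum (fun n => a (S n)) z)
     - (w - z) * psum a' z). ring. }
  apply Rle_trans with (/ rho * dd ^ 2 * B)%R.
  - apply (Cmod_series_le _ _ _ _ St HB). intros n.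
    change (Cmod (w * (w ^ n * a (S n)) + - (z * (z ^ n * a (S n))) + - ((w - z) * (z ^ n * a' n)))
     <= / rho * dd ^ 2 * (Cmod (RtoC (INR (S n)) * (RtoC (INR (S n)) * a (S n))) * rho ^ n))%R.
    replace (w * (w ^ n * a (S n)) + - (z * (z ^ n * a (S n))) + - ((w - z) * (z ^ n * a' n)))
      with ((w ^ S n - z ^ S n - (w - z) * (RtoC (INR (S n)) * z ^ n)) * a (S n))
      by (unfold a'; simpl; ring).
    assert (HL := pow_linearization rho z w n Hrho ltac:(lra) ltac:(lra)). fold dd in HL.
    rewrite !Cmod_mult, Cmod_R, (Rabs_pos_eq _ (pos_INR (S n))).
    set (E := Cmod (w ^ S n - z ^ S n - (w - z) * (RtoC (INR (S n)) * z ^ n))) in *.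
    apply Rmult_le_reg_l with (rho ^ 2)%R; [nra|].
    replace (rho ^ 2 * (/ rho * dd ^ 2 * (INR (S n) * (INR (S n) * Cmod (a (S n))) * rho ^ n)))%R
      with (INR (S n) ^ 2 * rho ^ S n * dd ^ 2 * Cmod (a (S n)))%R by (simpl (rho ^ S n)%R; field; lra).
    rewrite <- Rmult_assoc. apply Rmult_le_compat_r; [apply Cmod_ge_0|exact HL].
  - replace (/ rho * dd ^ 2 * B)%R with (/ rho * B * dd * dd)%R by ring.
    apply Rmult_le_compat_r; [exact Hdd|].
    apply Rmult_le_reg_l with rho; [lra|].
    replace (rho * (/ rho * B * dd))%R with (B * dd)%R by (field; lra).
    assert (Hdd2 : (dd * (B + 1) <= eps * rho)%R).
    { apply Rle_trans with (eps * rho / (B + 1) * (B + 1))%R.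
      - apply Rmult_le_compat_r; lra.
      - right. field. lra. }
    nra.
Qed.

Lemma holo_psum (n : nat) : forall a, disk_bounded a -> holo n (psum a).
Proof.
  induction n as [|n IH]; intros a Ha; [exact I|].
  exists (psum (fun n => RtoC (INR (S n)) * a (S n))). split.
  - intros z Hz. apply is_derive_psum; assumption.
  - apply IH. exact (disk_bounded_shift _ (disk_bounded_mult_nat a Ha)).
Qed.

Lemma psum_0 (a : nat -> C) : disk_bounded a -> psum a 0 = a 0%nat.
Proof.
  intros Ha.
  rewrite (psum_shift a 0 _ Ha in_disk_0 (psum_correct a 0 Ha in_disk_0)). ring.
Qed.

Lemma constant_term_unique (a b : nat -> C) :
  disk_bounded a -> disk_bounded b ->
  (forall z, in_disk z -> z <> 0 -> psum a z = psum b z) -> a 0%nat = b 0%nat.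
Proof.
  intros Ha Hb Heq. rewrite <- (psum_0 a Ha), <- (psum_0 b Hb).
  set (d := fun z => psum a z - psum b z).
  assert (Hd1 : holo 1 d) by (apply holo_minus; apply holo_psum; assumption).
  assert (Hd0 : d 0 = 0).
  { apply NNPP. intros Hne. assert (Hpos := proj1 (Cmod_gt_0 _) Hne).
    destruct (holo_continuous d 0 Hd1 in_disk_0 _ Hpos) as [r [Hr Hw]].
    set (t := (Rmin r 1 / 2)%R).
    assert (Ht : (0 < t < r /\ t < 1)%R)
      by (generalize (Rmin_l r 1) (Rmin_r r 1) (Rmin_glb_lt r 1 0 Hr Rlt_0_1); unfold t; lra).
    assert (Htm : Cmod (RtoC t) = t) by (rewrite Cmod_R, Rabs_pos_eq; lra).
    assert (Hdt : d (RtoC t) = 0).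
    { unfold d. rewrite Heq; [ring|unfold in_disk; lra|].
      intros E. rewrite E, Cmod_0 in Htm. lra. }
    specialize (Hw (RtoC t)). rewrite Hdt in Hw.
    replace (RtoC t - 0) with (RtoC t) in Hw by ring.
    replace (0 - d 0) with (- d 0) in Hw by ring.
    rewrite Htm, Cmod_opp in Hw. lra. }
  replace (psum a 0) with (d 0 + psum b 0) by (unfold d; ring). rewrite Hd0. ring.
Qed.

Lemma psum_coefficient_unique (n : nat) : forall a b : nat -> C,
  disk_bounded a -> disk_bounded b ->
  (forall z, in_disk z -> z <> 0 -> psum a z = psum b z) -> a n = b n.
Proof.
  induction n as [|n IH]; intros a b Ha Hb Heq; [apply constant_term_unique; assumption|].
  assert (H0 := constant_term_unique a b Ha Hb Heq).
  apply (IH (fun n => a (S n)) (fun n => b (S n)));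
    [apply disk_bounded_shift, Ha|apply disk_bounded_shift, Hb|].
  intros z Hz Hz0. specialize (Heq z Hz Hz0).
  rewrite (psum_shift a z _ Ha Hz (psum_correct a z Ha Hz)) in Heq.
  rewrite (psum_shift b z _ Hb Hz (psum_correct b z Hb Hz)), H0 in Heq.
  set (x := psum (fun n => a (S n)) z) in *. set (y := psum (fun n => b (S n)) z) in *.
  replace x with ((b 0%nat + z * x - b 0%nat) / z) by (field; exact Hz0).
  rewrite Heq. field. exact Hz0.
Qed.

Lemma taylor_coefficient_unique (f : C -> C) (a b : nat -> C) :
  taylor_expansion f a -> taylor_expansion f b -> forall n, a n = b n.
Proof.
  intros Hfa Hfb n.
  assert (Ha := disk_bounded_of_taylor f a Hfa). assert (Hb := disk_bounded_of_taylor f b Hfb).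
  apply psum_coefficient_unique; [exact Ha|exact Hb|]. intros z Hz _.
  rewrite (is_pseries_C_unique _ _ _ _ (psum_correct a z Ha Hz) (Hfa z Hz)).
  exact (is_pseries_C_unique _ _ _ _ (Hfb z Hz) (psum_correct b z Hb Hz)).
Qed.

(** * Solving k + psi(1/k) = x by continuation *)

(** The displacement [|N z - z|] attains its minimum on the ball, and [N] would decrease
    a nonzero minimum. *)
Lemma banach_closed_ball (N : C -> C) (c : C) (r q : R) :
  (0 <= r)%R -> (0 <= q < 1)%R ->
  (forall z, (Cmod (z - c) <= r)%R -> (Cmod (N z - c) <= r)%R) ->
  (forall z w, (Cmod (z - c) <= r)%R -> (Cmod (w - c) <= r)%R ->
     (Cmod (N z - N w) <= q * Cmod (z - w))%R) ->
  exists z, (Cmod (z - c) <= r)%R /\ N z = z.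
Proof.
  intros Hr Hq Hball Hlip.
  assert (Hc : forall w, (Cmod w <= r)%R -> (Cmod (c + w - c) <= r)%R).
  { intros w Hw. replace (c + w - c) with w by ring. exact Hw. }
  destruct (closed_disk_max (fun w => (- Cmod (N (c + w)%C - (c + w)))%R) r Hr) as [w0 [Hw0 Hmax]].
  - intros w Hw eps Heps. exists (eps / 2)%R. split; [lra|]. intros w' Hw' Hd.
    assert (H := Hlip _ _ (Hc w' Hw') (Hc w Hw)).
    replace (c + w' - (c + w)) with (w' - w) in H by ring.
    set (A := N (c + w') - (c + w')). set (B := N (c + w) - (c + w)).
    assert (HAB : (Cmod (A - B) < eps)%R).
    { replace (A - B) with ((N (c + w') - N (c + w)) - (w' - w)) by (unfold A, B; ring).
      apply Rle_lt_trans with (1 := Cmod_triangle_sub _ _).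
      generalize (Cmod_ge_0 (w' - w)). nra. }
    assert (T1 := Cmod_triangle_rev A B).
    assert (T2 := Cmod_triangle_rev B A). rewrite Cmod_sub_sym in T2.
    apply Rabs_def1; lra.
  - set (z := c + w0). assert (Hz := Hc w0 Hw0). fold z in Hz.
    exists z. split; [exact Hz|].
    assert (HNz := Hball z Hz).
    specialize (Hmax (N z - c) HNz). cbv beta in Hmax.
    replace (c + (N z - c)) with (N z) in Hmax by ring. fold z in Hmax.
    assert (HL := Hlip _ _ HNz Hz).
    assert (H0 : Cmod (N z - z) = 0%R) by (generalize (Cmod_ge_0 (N z - z)); nra).
    apply Cmod_eq_0 in H0. replace (N z) with (N z - z + z) by ring. rewrite H0. ring.
Qed.

Definition lipschitz1_on_disk (psi : C -> C) : Prop :=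
  forall z w, in_disk z -> in_disk w -> (Cmod (psi z - psi w) <= Cmod (z - w))%R.

Lemma in_disk_inv (k : C) : (1 < Cmod k)%R -> k <> 0 /\ in_disk (/ k).
Proof.
  intros Hk. assert (Hk0 : k <> 0) by (apply Cmod_gt_0; lra).
  split; [exact Hk0|]. unfold in_disk. rewrite Cmod_inv by exact Hk0.
  rewrite <- Rinv_1. apply Rinv_lt_contravar; lra.
Qed.

(** The map [k |-> x - psi (1/k)] contracts with ratio [1/s^2] outside the disk of radius
    [s], because inversion does. *)
Lemma solve_in_ball (psi : C -> C) (x k0 : C) (r s : R) :
  lipschitz1_on_disk psi -> (0 <= r)%R -> (1 < s)%R -> (s + r <= Cmod k0)%R ->
  (Cmod (x - psi (/ k0)%C - k0) <= r * (1 - / s ^ 2))%R ->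
  exists k, (s <= Cmod k)%R /\ k + psi (/ k) = x.
Proof.
  intros Hpsi Hr Hs Hk0 Hx.
  assert (Hs2 : (1 < s ^ 2)%R) by nra.
  assert (Hq : (0 < / s ^ 2 < 1)%R).
  { split; [apply Rinv_0_lt_compat; lra|]. rewrite <- Rinv_1. apply Rinv_lt_contravar; lra. }
  assert (Hbig : forall k, (Cmod (k - k0) <= r)%R -> (s <= Cmod k)%R).
  { intros k Hk. generalize (Cmod_triangle_rev k0 k). rewrite Cmod_sub_sym. lra. }
  assert (Hlip : forall z w, (Cmod (z - k0) <= r)%R -> (Cmod (w - k0) <= r)%R ->
     (Cmod (x - psi (/ z)%C - (x - psi (/ w)%C)) <= / s ^ 2 * Cmod (z - w))%R).
  { intros z w Hz Hw. apply Hbig in Hz, Hw.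
    destruct (in_disk_inv z ltac:(lra)) as [Hz0 Hzd].
    destruct (in_disk_inv w ltac:(lra)) as [Hw0 Hwd].
    replace (x - psi (/ z) - (x - psi (/ w))) with (psi (/ w) - psi (/ z)) by ring.
    apply Rle_trans with (1 := Hpsi _ _ Hwd Hzd).
    replace (/ w - / z) with ((z - w) * (/ z * / w)) by (field; auto).
    rewrite !Cmod_mult, !Cmod_inv, Rmult_comm by assumption.
    apply Rmult_le_compat_r; [apply Cmod_ge_0|].
    rewrite <- Rinv_mult. apply Rinv_le_contravar; nra. }
  assert (Hkk : (Cmod (k0 - k0) <= r)%R).
  { replace (k0 - k0) with (RtoC 0) by ring. rewrite Cmod_0. exact Hr. }
  destruct (banach_closed_ball (fun k => x - psi (/ k)) k0 r (/ s ^ 2)) as [k [Hk1 Hk2]].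
  - exact Hr.
  - lra.
  - intros z Hz. assert (H := Hlip z k0 Hz Hkk).
    replace (x - psi (/ z) - k0)
      with ((x - psi (/ z) - (x - psi (/ k0))) + (x - psi (/ k0) - k0)) by ring.
    apply Rle_trans with (1 := Cmod_triangle _ _). nra.
  - exact Hlip.
  - exists k. split; [apply Hbig, Hk1|]. cbv beta in Hk2. rewrite <- Hk2 at 1. ring.
Qed.

(** Walk inwards on the ray of [x] from a far point, where the equation is solved by
    contraction. As solutions keep outside the disk of radius [sigma], the admissible
    step [eta] is the same everywhere, so finitely many steps lead to [x]. *)
Lemma solve_by_continuation (psi : C -> C) (x : C) (sigma : R) :
  lipschitz1_on_disk psi -> psi 0 = 0 -> x <> 0 -> (1 < sigma)%R ->
  (forall (t : R) (k : C), (1 <= t)%R -> (1 < Cmod k)%R ->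
     k + psi (/ k) = RtoC t * x -> (sigma <= Cmod k)%R) ->
  exists k, (1 < Cmod k)%R /\ k + psi (/ k) = x.
Proof.
  intros Hpsi Hpsi0 Hx Hsig Hap.
  set (s := ((sigma + 1) / 2)%R). set (r := ((sigma - 1) / 2)%R).
  assert (Hs : (1 < s)%R) by (unfold s; lra). assert (Hr : (0 < r)%R) by (unfold r; lra).
  assert (Hx0 := proj1 (Cmod_gt_0 x) Hx).
  assert (Hq : (/ s ^ 2 < 1)%R) by (rewrite <- Rinv_1; apply Rinv_lt_contravar; nra).
  set (eta := (r * (1 - / s ^ 2) / Cmod x)%R).
  assert (Heta : (0 < eta)%R) by (apply Rdiv_lt_0_compat; nra).
  set (P := fun t : R => exists k, (1 < Cmod k)%R /\ k + psi (/ k) = RtoC t * x).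
  assert (Hstep : forall n, P (1 + INR n * eta)%R -> P 1%R).
  { induction n as [|n IH]; intros H.
    - simpl in H. replace (1 + 0 * eta)%R with 1%R in H by ring. exact H.
    - apply IH. destruct H as [k0 [Hk0 Hk0e]].
      assert (Hn : (0 <= INR n * eta)%R) by (generalize (pos_INR n); nra).
      assert (Hk0s : (sigma <= Cmod k0)%R).
      { apply (Hap (1 + INR (S n) * eta)%R); auto. rewrite S_INR. lra. }
      destruct (solve_in_ball psi (RtoC (1 + INR n * eta) * x) k0 r s) as [k [Hk1 Hk2]];
        try lra; auto.
      + unfold s, r. lra.
      + replace (RtoC (1 + INR n * eta) * x - psi (/ k0) - k0)
          with (RtoC (1 + INR n * eta) * x - (k0 + psi (/ k0))) by ring.
        rewrite Hk0e, S_INR.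
        replace (RtoC (1 + INR n * eta) * x - RtoC (1 + (INR n + 1) * eta) * x)
          with (RtoC (- eta) * x).
        2:{ replace (- eta)%R with ((1 + INR n * eta) - (1 + (INR n + 1) * eta))%R by ring.
            rewrite RtoC_minus. ring. }
        rewrite Cmod_mult, Cmod_R, Rabs_Ropp, Rabs_pos_eq by lra.
        unfold eta. right. field. split; lra.
      + exists k. split; [lra|exact Hk2]. }
  destruct (nfloor_ex (3 / Cmod x / eta)) as [N [_ HN]].
  { apply Rlt_le, Rdiv_lt_0_compat; [apply Rdiv_lt_0_compat; lra|exact Heta]. }
  destruct (Hstep (S N)) as [k Hk].
  - set (y := RtoC (1 + INR (S N) * eta) * x).
    assert (HNe : (3 / Cmod x < INR (S N) * eta)%R).
    { apply Rmult_lt_reg_r with (/ eta)%R; [apply Rinv_0_lt_compat, Heta|].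
      rewrite (Rmult_assoc _ eta), Rinv_r, S_INR by lra. unfold Rdiv in *. lra. }
    assert (Hy : (3 <= Cmod y)%R).
    { unfold y. rewrite Cmod_mult, Cmod_R, Rabs_pos_eq by (generalize (Rdiv_lt_0_compat 3 _ ltac:(lra) Hx0); lra).
      apply Rle_trans with (3 / Cmod x * Cmod x)%R; [right; field; lra|].
      apply Rmult_le_compat_r; lra. }
    destruct (in_disk_inv y ltac:(lra)) as [Hy0 Hyd].
    destruct (solve_in_ball psi y y 1 2) as [k [Hk1 Hk2]]; try lra; auto.
    + replace (y - psi (/ y) - y) with (psi 0 - psi (/ y)) by (rewrite Hpsi0; ring).
      apply Rle_trans with (1 := Hpsi _ _ ltac:(unfold in_disk; rewrite Cmod_0; lra) Hyd).
      replace (0 - / y) with (- / y) by ring. rewrite Cmod_opp, Cmod_inv by exact Hy0.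
      apply Rle_trans with (/ 3)%R; [apply Rinv_le_contravar; lra|lra].
    + exists k. split; [lra|exact Hk2].
  - exists k. split; [tauto|]. rewrite (proj2 Hk). ring.
Qed.

(** * Bounds on the second and third coefficients *)

(** For [1 / f = 1/v - x + psi v] this says that [f] has no pole in the disk. *)
Definition omits (psi : C -> C) (x : C) : Prop :=
  forall v, in_disk v -> v <> 0 -> / v + psi v <> x.

Lemma omits_no_solution (psi : C -> C) (x : C) :
  omits psi x -> ~ exists k, (1 < Cmod k)%R /\ k + psi (/ k) = x.
Proof.
  intros H [k [Hk Hkx]]. destruct (in_disk_inv k Hk) as [Hk0 Hkd].
  apply (H (/ k) Hkd).
  - intros E. assert (E1 : k * / k = 1) by (field; exact Hk0).
    rewrite E, Cmult_0_r in E1. apply (f_equal Cmod) in E1.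
    rewrite Cmod_0, Cmod_1 in E1. lra.
  - rewrite <- Hkx. f_equal. field. exact Hk0.
Qed.

(** A solution of [k + psi (1/k) = t x] satisfies [t |x| <= |k| + 1], which for
    [|x| > 2] keeps [|k|] away from one. *)
Lemma second_coefficient_bound (psi : C -> C) (x : C) :
  lipschitz1_on_disk psi -> psi 0 = 0 -> omits psi x -> (Cmod x <= 2)%R.
Proof.
  intros Hpsi Hpsi0 Hom. apply Rnot_lt_le. intros Hlt.
  apply (omits_no_solution psi x Hom).
  apply (solve_by_continuation psi x (Cmod x - 1)); auto; try lra.
  - apply Cmod_gt_0. lra.
  - intros t k Ht Hk Heq. destruct (in_disk_inv k Hk) as [Hk0 Hkd].
    assert (Hs := Hpsi _ _ Hkd in_disk_0). rewrite Hpsi0 in Hs.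
    replace (psi (/ k) - 0) with (psi (/ k)) in Hs by ring.
    replace (/ k - 0) with (/ k) in Hs by ring.
    unfold in_disk in Hkd.
    assert (Hx : (Cmod (RtoC t * x) <= Cmod k + 1)%R).
    { rewrite <- Heq. apply Rle_trans with (1 := Cmod_triangle _ _). lra. }
    rewrite Cmod_mult, Cmod_R, Rabs_pos_eq in Hx by lra. nra.
Qed.

(** Since [|z - v| <= |1 - conj v * z|], the function
    [(psi z - psi v) / (1 - conj v * z)] maps the disk to the closed disk; the inequality
    is the Schwarz-Pick bound on its first two coefficients. *)
Lemma schwarz_pick_difference_quotient (phi psi : C -> C) :
  holo 2 phi -> (forall z, psi z = z * phi z) -> lipschitz1_on_disk psi ->
  forall v, in_disk v ->
  (Cmod (phi 0 - psi v * Cconj v) <= 1 - Cmod (psi v) ^ 2)%R.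
Proof.
  intros Hphi Hpp Hpsi v Hv.
  set (s := psi v).
  assert (Hden : forall z, in_disk z -> 1 - Cconj v * z <> 0).
  { intros z Hz Heq.
    assert (H1 : Cconj v * z = 1) by (replace (Cconj v * z) with (1 - (1 - Cconj v * z)) by ring; rewrite Heq; ring).
    apply (f_equal Cmod) in H1. rewrite Cmod_1, Cmod_mult, Cmod_conj in H1.
    unfold in_disk in Hz, Hv. generalize (Cmod_ge_0 z) (Cmod_ge_0 v). nra. }
  set (h := fun z => (phi z - s * Cconj v) * / (1 - Cconj v * z)).
  assert (H := schwarz_pick_coefficient h (- s) 1).
  replace (phi 0 - s * Cconj v) with (h 0).
  2:{ unfold h. field. }
  rewrite <- (Cmod_opp s). apply H; [|lia|].
  - unfold h. apply holo_mult.
    + apply holo_minus; [exact Hphi|apply holo_const].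
    + apply holo_inv; [|exact Hden].
      apply holo_minus; [apply holo_const|].
      apply holo_mult; [apply holo_const|apply holo_id].
  - intros z Hz. assert (Hdz := Hden z Hz).
    replace (- s + z ^ 1 * h z) with ((psi z - psi v) / (1 - Cconj v * z)).
    2:{ unfold h. fold s. rewrite (Hpp z). field. exact Hdz. }
    rewrite Cmod_div by exact Hdz.
    assert (Hpos := proj1 (Cmod_gt_0 _) Hdz).
    apply Rmult_le_reg_r with (Cmod (1 - Cconj v * z)); [exact Hpos|].
    unfold Rdiv. rewrite Rmult_assoc, Rinv_l, Rmult_1_r, Rmult_1_l by lra.
    apply Rle_trans with (1 := Hpsi z v Hz Hv).
    unfold in_disk in Hz, Hv. apply moebius_le; lra.
Qed.

Lemma scaling_increases_distance (X c : C) (tau : R) :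
  (Cmod c <= Cmod X)%R -> (1 <= tau)%R -> (Cmod (X - c) <= Cmod (RtoC tau * X - c))%R.
Proof.
  intros Hc Ht.
  apply Rsqr_incr_0; try apply Cmod_ge_0. rewrite !Rsqr_pow2.
  assert (Hid : (Cmod (RtoC tau * X - c) ^ 2 - Cmod (X - c) ^ 2
    = (tau - 1) * ((tau + 1) * Cmod X ^ 2 - 2 * Re (X * Cconj c)))%R).
  { rewrite !Cmod2_alt. destruct X, c. simpl. ring. }
  assert (Hre : (Re (X * Cconj c) <= Cmod X * Cmod c)%R).
  { apply Rle_trans with (1 := Rle_abs _). apply Rle_trans with (1 := re_le_Cmod _).
    rewrite Cmod_mult, Cmod_conj. lra. }
  generalize (Cmod_ge_0 X) (Cmod_ge_0 c); intros HX0 Hc0.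
  assert (Cmod X * Cmod c <= Cmod X ^ 2)%R by nra.
  assert (0 <= (tau + 1) * Cmod X ^ 2 - 2 * Re (X * Cconj c))%R by nra.
  nra.
Qed.

(** Let [k + s = t x] with [s = psi (1/k)] and [K = |k|]. By [schwarz_pick_difference_quotient]
    [phi 0 = s conj(1/k) + e] with [|e| <= 1 - |s|^2], so
    [(t x)^2 - phi 0 = k^2 + s (2 k - conj(1/k)) + (s^2 - e)] is at most
    [K^2 + (2 K - 1/K) + 1] in modulus. This tends to 3 as [K] tends to 1, so a value of
    [|x^2 - phi 0|] above 3 keeps [K] away from 1. *)
Lemma third_coefficient_bound (phi psi : C -> C) (x : C) :
  holo 2 phi -> (forall z, psi z = z * phi z) -> lipschitz1_on_disk psi ->
  (Cmod (phi 0) <= 1)%R -> omits psi x -> (Cmod (x * x - phi 0) <= 3)%R.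
Proof.
  intros Hphi Hpp Hpsi Hc Hom. set (c := phi 0) in *.
  apply Rnot_lt_le. intros Hlt.
  assert (Hpsi0 : psi 0 = 0) by (rewrite Hpp; ring).
  apply (omits_no_solution psi x Hom).
  (* needed for the distance to phi 0 to grow along the ray *)
  assert (Hx1 : (1 < Cmod x)%R).
  { assert (H := Cmod_triangle_sub (x * x) c). rewrite Cmod_mult in H.
    generalize (Cmod_ge_0 x). nra. }
  set (e := (Cmod (x * x - c) - 3)%R).
  assert (He : (0 < e)%R) by (unfold e; lra).
  (* e <= (K - 1) (K + 4) below, and K + 4 <= 6 if K <= 2 *)
  apply (solve_by_continuation psi x (1 + Rmin 1 (e / 6))); auto.
  - apply Cmod_gt_0. lra.
  - assert (0 < Rmin 1 (e / 6))%R by (apply Rmin_glb_lt; lra). lra.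
  - intros t k Ht Hk Heq. destruct (in_disk_inv k Hk) as [Hk0 Hkd].
    set (s := psi (/ k)) in *.
    assert (HP := schwarz_pick_difference_quotient phi psi Hphi Hpp Hpsi (/ k) Hkd).
    fold s c in HP.
    assert (HK := Cmod_inv k Hk0).
    assert (Hs := Hpsi _ _ Hkd in_disk_0). rewrite Hpsi0 in Hs. fold s in Hs.
    replace (s - 0) with s in Hs by ring. replace (/ k - 0) with (/ k) in Hs by ring.
    set (K := Cmod k) in *.
    assert (HiK : (0 < / K < 1)%R) by (unfold in_disk in Hkd; rewrite HK in Hkd; split; [apply Rinv_0_lt_compat; lra|exact Hkd]).
    assert (Hmon : (Cmod (x * x - c) <= Cmod (RtoC (t * t) * (x * x) - c))%R).
    { apply scaling_increases_distance; [rewrite Cmod_mult; nra|nra]. }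
    replace (RtoC (t * t) * (x * x)) with ((k + s) * (k + s)) in Hmon
      by (rewrite Heq, RtoC_mult; ring).
    replace ((k + s) * (k + s) - c)
      with (k * k + (s * (2 * k - Cconj (/ k)) + (s * s - (c - s * Cconj (/ k))))) in Hmon by ring.
    assert (B1 : (Cmod (k * k) = K * K)%R) by (apply Cmod_mult).
    assert (B2 : (Cmod (2 * k - Cconj (/ k)) <= 2 * K - / K)%R).
    { replace (2 * k - Cconj (/ k)) with (k * RtoC (2 - / K * / K)).
      - rewrite Cmod_mult, Cmod_R, Rabs_pos_eq by nra. fold K. right. field. lra.
      - rewrite RtoC_minus, RtoC_mult, <- HK.
        replace (RtoC (Cmod (/ k)) * RtoC (Cmod (/ k))) with (/ k * Cconj (/ k)).
        + field. exact Hk0.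
        + rewrite <- Cmod2_conj, RtoC_pow. ring. }
    assert (B3 : (Cmod (s * s - (c - s * Cconj (/ k))) <= 1)%R).
    { apply Rle_trans with (1 := Cmod_triangle_sub _ _). rewrite Cmod_mult. lra. }
    assert (B4 : (Cmod (x * x - c) <= K * K + (2 * K - / K) + 1)%R).
    { apply Rle_trans with (1 := Hmon).
      apply Rle_trans with (1 := Cmod_triangle _ _). rewrite B1, Rplus_assoc.
      apply Rplus_le_compat_l. apply Rle_trans with (1 := Cmod_triangle _ _).
      apply Rplus_le_compat; [|exact B3]. rewrite Cmod_mult.
      generalize (Cmod_ge_0 s) (Cmod_ge_0 (2 * k - Cconj (/ k))). rewrite HK in Hs. nra. }
    (* K + 1/K >= 2 turns the bound into the polynomial K^2 + 3 K - 1, still 3 at K = 1 *)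
    assert (B5 : (2 <= K + / K)%R).
    { assert (K * / K = 1)%R by (apply Rinv_r; lra). nra. }
    assert (B6 : (e <= (K - 1) * (K + 4))%R) by (unfold e; lra).
    apply Rnot_lt_le. intros HKs.
    generalize (Rmin_l 1 (e / 6)) (Rmin_r 1 (e / 6)); intros.
    nra.
Qed.

(** * The class U through the reciprocal of f *)

Lemma is_derive_C_ext_disk (f g : C -> C) (z l : C) :
  (forall w, in_disk w -> f w = g w) -> in_disk z -> is_derive f z l -> is_derive g z l.
Proof.
  intros Hfg Hz H. apply is_derive_C_iff. intros eps Heps.
  destruct (proj1 (is_derive_C_iff _ _ _) H eps Heps) as [d [Hd Hw]].
  unfold in_disk in *.
  exists (Rmin d (1 - Cmod z)). split; [apply Rmin_glb_lt; lra|].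
  intros w Hwz. generalize (Rmin_l d (1 - Cmod z)) (Rmin_r d (1 - Cmod z)); intros M1 M2.
  rewrite <- (Hfg z Hz), <- (Hfg w); [apply Hw; lra|].
  generalize (Cmod_triangle_rev w z). lra.
Qed.

Lemma holo_affine (n : nat) (c : C) (g : C -> C) : holo n g -> holo n (fun z => c + z * g z).
Proof.
  intros Hg. apply holo_plus; [apply holo_const|]. apply holo_mult; [apply holo_id|exact Hg].
Qed.

Lemma is_derive_affine (c z : C) (g : C -> C) (g' : C) :
  is_derive g z g' -> is_derive (fun w => c + w * g w) z (g z + z * g').
Proof.
  intros Hg. eapply is_derive_C_eq.
  - apply is_derive_Cplus; [apply is_derive_Cconst|].
    apply is_derive_Cmult; [apply is_derive_Cid|exact Hg].
  - cbv beta. ring.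
Qed.

Lemma taylor_remainder (f : C -> C) (a : nat -> C) : taylor_expansion f a ->
  exists g, (forall n, holo n g) /\ forall z, in_disk z ->
   f z = a 0%nat + z * (a 1%nat + z * (a 2%nat + z * (a 3%nat + z * (a 4%nat + z * (a 5%nat + z * g z))))).
Proof.
  intros Hf. assert (H0 := disk_bounded_of_taylor f a Hf).
  assert (H1 := disk_bounded_shift _ H0). assert (H2 := disk_bounded_shift _ H1).
  assert (H3 := disk_bounded_shift _ H2). assert (H4 := disk_bounded_shift _ H3).
  assert (H5 := disk_bounded_shift _ H4). assert (H6 := disk_bounded_shift _ H5).
  exists (psum (fun n => a (S (S (S (S (S (S n)))))))). split.
  - intros n. apply holo_psum, H6.
  - intros z Hz. rewrite (psum_shift a z _ H0 Hz (Hf z Hz)).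
    rewrite (psum_shift _ z _ H1 Hz (psum_correct _ z H1 Hz)).
    rewrite (psum_shift _ z _ H2 Hz (psum_correct _ z H2 Hz)).
    rewrite (psum_shift _ z _ H3 Hz (psum_correct _ z H3 Hz)).
    rewrite (psum_shift _ z _ H4 Hz (psum_correct _ z H4 Hz)).
    rewrite (psum_shift _ z _ H5 Hz (psum_correct _ z H5 Hz)). reflexivity.
Qed.

(** The function [z / f] is [1 - a2 z + z psi z]. Its expansion is computed with a
    remainder [z^5 R z] that is a quotient of power series, so that [R] is differentiable
    to all orders on the whole disk; that [z / f] itself has a power series there would
    take Cauchy's theorem. *)
Lemma class_U_reciprocal (f : C -> C) (a : nat -> C) :
  class_U f -> taylor_expansion f a ->
  let b2 := a 2%nat * a 2%nat - a 3%nat in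
  let b3 := a 2%nat * a 3%nat - a 4%nat - b2 * a 2%nat in
  let b4 := a 2%nat * a 4%nat - a 5%nat - b2 * a 3%nat - b3 * a 2%nat in
  exists R : C -> C, (forall n, holo n R) /\ forall z, in_disk z ->
    f z * (1 - a 2%nat * z + z * (z * (b2 + z * (b3 + z * (b4 + z * R z))))) = z /\
    1 - a 2%nat * z + z * (z * (b2 + z * (b3 + z * (b4 + z * R z)))) <> 0.
Proof.
  intros [[_ [a' [Ha0 [Ha1 Ha']]]] [Hf0 _]] Ha b2 b3 b4.
  assert (Haa := taylor_coefficient_unique f a a' Ha Ha').
  rewrite <- Haa in Ha0, Ha1. clear a' Ha' Haa.
  destruct (taylor_remainder f a Ha) as [g [Hg Hfg]].
  rewrite Ha0, Ha1 in Hfg.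
  set (a2 := a 2%nat) in *. set (a3 := a 3%nat) in *. set (a4 := a 4%nat) in *.
  set (a5 := a 5%nat) in *.
  set (F := fun z => 1 + z * (a2 + z * (a3 + z * (a4 + z * (a5 + z * g z))))).
  assert (HF : forall z, in_disk z -> F z <> 0).
  { intros z Hz Heq. destruct (Ceq_dec z 0) as [E|Hz0].
    - unfold F in Heq. rewrite E, Cmult_0_l, Cplus_0_r in Heq.
      apply (f_equal Cmod) in Heq. rewrite Cmod_1, Cmod_0 in Heq. lra.
    - apply (Hf0 z Hz Hz0). rewrite (Hfg z Hz). fold (F z). rewrite Heq. ring. }
  (* the numerator of R is what remains, after division by z^5, of
     1 - (1 - a2 z + b2 z^2 + b3 z^3 + b4 z^4) F: the b's annihilate the lower terms *)
  set (N := fun z => (- g z + a2 * a5 - b2 * a4 - b3 * a3 - b4 * a2)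
     + z * ((a2 * g z - b2 * a5 - b3 * a4 - b4 * a3)
     + z * ((- b2 * g z - b3 * a5 - b4 * a4)
     + z * ((- b3 * g z - b4 * a5) + z * (- b4 * g z))))).
  exists (fun z => N z * / F z). split.
  - intros n. apply holo_mult.
    + unfold N. specialize (Hg n).
      repeat first [exact Hg | apply holo_id | apply holo_const | apply holo_opp; exact Hg
                   | apply holo_minus | apply holo_plus | apply holo_mult].
    + apply holo_inv; [|exact HF]. unfold F. do 4 apply holo_affine. apply (holo_affine _ a5), Hg.
  - intros z Hz. assert (HFz := HF z Hz).
    set (G := 1 - a2 * z + z * (z * (b2 + z * (b3 + z * (b4 + z * (N z * / F z)))))).
    assert (HFG : F z * G = 1).
    { transitivity (F z * (1 - a2 * z + z * (z * (b2 + z * (b3 + z * b4)))) + z ^ 5 * N z).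
      - unfold G. field. exact HFz.
      - unfold F, N, b4, b3, b2. ring. }
    split.
    + rewrite (Hfg z Hz). fold (F z).
      replace ((0 + z * F z) * G) with (z * (F z * G)) by ring. rewrite HFG. ring.
    + intros E. rewrite E, Cmult_0_r in HFG.
      apply (f_equal Cmod) in HFG. rewrite Cmod_1, Cmod_0 in HFG. lra.
Qed.

(** The expression [(z/f)^2 f'] equals [- z^2 (1/f)'], and [(1/f)' = - 1/z^2 + psi']. *)
Lemma U_functional_of_reciprocal (f psi : C -> C) (psi' x z : C) :
  (forall w, in_disk w -> f w * (1 - x * w + w * psi w) = w /\ 1 - x * w + w * psi w <> 0) ->
  in_disk z -> is_derive psi z psi' ->
  z_over f z ^ 2 * C_derive f z - 1 = - (z ^ 2 * psi').
Proof.
  intros Hf Hz Hpsi.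
  set (G := fun w => 1 - x * w + w * psi w).
  assert (HG : is_derive G z (- x + psi z + z * psi')).
  { eapply is_derive_C_eq.
    - apply is_derive_Cplus.
      + apply is_derive_Cplus; [apply is_derive_Cconst|].
        apply (is_derive_opp (fun w : C => x * w)).
        apply is_derive_Cmult; [apply is_derive_Cconst|apply is_derive_Cid].
      + apply is_derive_Cmult; [apply is_derive_Cid|exact Hpsi].
    - change (0 + - (0 * z + x * 1) + (1 * psi z + z * psi') = - x + psi z + z * psi'). ring. }
  assert (HfG : forall w, in_disk w -> w * / G w = f w).
  { intros w Hw. destruct (Hf w Hw) as [H1 H2]. fold (G w) in H1, H2.
    rewrite <- H1 at 1. field. exact H2. }
  assert (HG0 : G z <> 0) by (exact (proj2 (Hf z Hz))).
  assert (Hd : is_derive f z (/ G z + z * ((- x + psi z + z * psi') * (- / G z * / G z)))).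
  { apply (is_derive_C_ext_disk _ _ _ _ HfG Hz).
    eapply is_derive_C_eq.
    - apply is_derive_Cmult; [apply is_derive_Cid|]. apply is_derive_Cinv; [exact HG|exact HG0].
    - cbv beta. ring. }
  rewrite (is_C_derive_unique f z _ Hd).
  assert (HzG : z_over f z = G z).
  { unfold z_over. destruct (Ceq_dec z 0) as [E|Hz0].
    - unfold G. rewrite E. ring.
    - rewrite <- (HfG z Hz). field. split; assumption. }
  rewrite HzG.
  transitivity (G z - z * (- x + psi z + z * psi') - 1); [field; exact HG0|].
  unfold G. ring.
Qed.

Lemma in_disk_segment (z h : C) (t : R) :
  (0 <= t <= 1)%R -> in_disk z -> in_disk (z + h) -> in_disk (z + RtoC t * h).
Proof.
  unfold in_disk. intros Ht Hz Hw.
  replace (z + RtoC t * h) with (RtoC (1 - t) * z + RtoC t * (z + h))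
    by (rewrite RtoC_minus; ring).
  apply Rle_lt_trans with (1 := Cmod_triangle _ _).
  rewrite !Cmod_mult, !Cmod_R, !Rabs_pos_eq by lra. destruct (Rle_lt_dec t (1 / 2)); nra.
Qed.

Lemma lipschitz1_of_derive (psi p : C -> C) :
  (forall z, in_disk z -> is_derive psi z (p z)) ->
  (forall z, in_disk z -> (Cmod (p z) <= 1)%R) -> lipschitz1_on_disk psi.
Proof.
  intros Hd Hp z w Hz Hw.
  replace (psi z) with (psi (w + (z - w))) by (f_equal; ring).
  rewrite <- (Rmult_1_l (Cmod (z - w))).
  assert (Hseg : forall t, (0 <= t <= 1)%R -> in_disk (w + RtoC t * (z - w))).
  { intros t Ht. apply in_disk_segment; auto. replace (w + (z - w)) with z by ring. exact Hz. }
  apply (mean_value_inequality psi p); auto.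
Qed.

(** With [x = |b2|] the two bounds come to [2 x + (1 - x^2) / 2 <= 2] and
    [3 x + (4/3) (1 - x^2) <= 3] for [0 <= x <= 1]. *)
Lemma class_U_coefficient_bounds (f : C -> C) (a : nat -> C) :
  class_U f -> taylor_expansion f a ->
  (Cmod (a 2%nat * a 3%nat - a 4%nat) <= 2)%R /\
  (Cmod (a 2%nat * a 4%nat - a 5%nat) <= 3)%R.
Proof.
  intros HU Ha.
  destruct (class_U_reciprocal f a HU Ha) as [R0 [HR Hrec]].
  set (b2 := a 2%nat * a 2%nat - a 3%nat) in *.
  set (b3 := a 2%nat * a 3%nat - a 4%nat - b2 * a 2%nat) in *.
  set (b4 := a 2%nat * a 4%nat - a 5%nat - b2 * a 3%nat - b3 * a 2%nat) in *.
  set (a2 := a 2%nat) in *.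
  set (phi := fun z => b2 + z * (b3 + z * (b4 + z * R0 z))).
  set (psi := fun z => z * phi z).
  destruct (HR 3%nat) as [R1 [HR1 HR1']].
  set (p := fun z => b2 + z * (2 * b3 + z * (3 * b4 + z * (4 * R0 z + z * R1 z)))).
  assert (Htail : holo 2 (fun z => 4 * R0 z + z * R1 z)).
  { apply holo_plus; apply holo_mult; auto using holo_const, holo_id. }
  assert (Hp2 : holo 2 p).
  { unfold p. do 3 apply holo_affine. exact Htail. }
  assert (Hphi2 : holo 2 phi).
  { unfold phi. do 3 apply holo_affine. apply HR. }
  assert (Hder : forall z, in_disk z -> is_derive psi z (p z)).
  { intros z Hz. unfold psi, phi. eapply is_derive_C_eq.
    - apply is_derive_Cmult; [apply is_derive_Cid|].
      do 3 apply is_derive_affine. exact (HR1 z Hz).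
    - unfold p. cbv beta. ring. }
  assert (Hp : forall z, in_disk z -> (Cmod (p z) <= 1)%R).
  { apply (schwarz_pow p 2 Hp2). intros z Hz. apply Rlt_le.
    rewrite <- Cmod_opp, <- (U_functional_of_reciprocal f psi (p z) a2 z Hrec Hz (Hder z Hz)).
    apply HU, Hz. }
  assert (Hlip := lipschitz1_of_derive psi p Hder Hp).
  assert (Hom : omits psi a2).
  { intros v Hv Hv0 Heq. apply (proj2 (Hrec v Hv)).
    fold (phi v). fold (psi v). rewrite <- Heq. field. exact Hv0. }
  assert (Hphi0 : phi 0 = b2) by (unfold phi; ring).
  assert (Hpsi0 : psi 0 = 0) by (unfold psi; ring).
  assert (HB2 : (Cmod b2 <= 1)%R).
  { replace b2 with (p 0) by (unfold p; ring). apply Hp, in_disk_0. }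
  assert (HA2 := second_coefficient_bound psi a2 Hlip Hpsi0 Hom).
  assert (HA3 := third_coefficient_bound phi psi a2 Hphi2 (fun _ => eq_refl) Hlip).
  rewrite Hphi0 in HA3. specialize (HA3 HB2 Hom).
  replace (a2 * a2 - b2) with (a 3%nat) in HA3 by (unfold b2; ring).
  assert (HB3 : (2 * Cmod b3 <= 1 - Cmod b2 ^ 2)%R).
  { set (h := fun z => 2 * b3 + z * (3 * b4 + z * (4 * R0 z + z * R1 z))).
    replace (2 * Cmod b3)%R with (Cmod (h 0)).
    2:{ replace (h 0) with (2 * b3) by (unfold h; ring).
        rewrite Cmod_mult, Cmod_R, Rabs_pos_eq; lra. }
    apply (schwarz_pick_coefficient h b2 1).
    - unfold h. do 2 apply holo_affine. exact Htail.
    - lia.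
    - intros z Hz. replace (b2 + z ^ 1 * h z) with (p z) by (unfold p, h; ring). auto. }
  (* the even part of p has no linear term, so its quadratic coefficient obeys
     the same inequality as the linear coefficient of p *)
  assert (HB4 : (3 * Cmod b4 <= 1 - Cmod b2 ^ 2)%R).
  { set (h := fun z => 3 * b4 + z * (2 * (R0 z - R0 (- z)))
                       + z * z * (/ 2 * (R1 z + R1 (- z)))).
    replace (3 * Cmod b4)%R with (Cmod (h 0)).
    2:{ replace (h 0) with (3 * b4) by (unfold h; ring).
        rewrite Cmod_mult, Cmod_R, Rabs_pos_eq; lra. }
    apply (schwarz_pick_coefficient h b2 2).
    - unfold h. repeat apply holo_plus.
      + apply holo_const.
      + apply holo_mult; [apply holo_id|]. apply holo_mult; [apply holo_const|].
        apply holo_minus; [apply HR|apply holo_reflect, HR].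
      + apply holo_mult; [apply holo_mult; apply holo_id|].
        apply holo_mult; [apply holo_const|].
        apply holo_plus; [exact HR1'|apply holo_reflect, HR1'].
    - lia.
    - intros z Hz. replace (b2 + z ^ 2 * h z) with (/ 2 * (p z + p (- z)))
        by (unfold p, h; field).
      assert (H1 := Hp z Hz). assert (H2 := Hp (- z) (in_disk_opp z Hz)).
      rewrite Cmod_mult, Cmod_inv, Cmod_R, Rabs_pos_eq by (try lra; intros E; injection E; lra).
      generalize (Cmod_triangle (p z) (p (- z))). lra. }
  generalize (Cmod_ge_0 b2) (Cmod_ge_0 b3) (Cmod_ge_0 b4) (Cmod_ge_0 a2) (Cmod_ge_0 (a 3%nat));
    intros P2 P3 P4 PA2 PA3.
  split.
  - replace (a2 * a 3%nat - a 4%nat) with (b3 + a2 * b2) by (unfold b3; ring).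
    apply Rle_trans with (1 := Cmod_triangle _ _). rewrite Cmod_mult. nra.
  - replace (a2 * a 4%nat - a 5%nat) with (b4 + (b2 * a 3%nat + b3 * a2)) by (unfold b4; ring).
    apply Rle_trans with (1 := Cmod_triangle _ _).
    apply Rle_trans with (Cmod b4 + (Cmod b2 * 3 + Cmod b3 * 2))%R.
    + apply Rplus_le_compat_l. apply Rle_trans with (1 := Cmod_triangle _ _).
      rewrite !Cmod_mult. apply Rplus_le_compat; apply Rmult_le_compat_l; assumption.
    + nra.
Qed.

(** * The Koebe function and its rotations *)

(** The rotation of the Koebe function by the angle [theta] is [z / (1 - c z)^2] for
    [c = cis theta]. *)
Definition is_koebe_rotation (c : C) (f : C -> C) : Prop :=
  Cmod c = 1%R /\ forall z, f z = z / (1 - c * z) ^ 2.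

Definition koebe_coefficient (c : C) (n : nat) : C := RtoC (INR n) * c ^ pred n.

Lemma one_sub_mult_neq_0 (c z : C) : Cmod c = 1%R -> in_disk z -> 1 - c * z <> 0.
Proof.
  unfold in_disk. intros Hc Hz E.
  assert (H : c * z = 1) by (replace (c * z) with (1 - (1 - c * z)) by ring; rewrite E; ring).
  apply (f_equal Cmod) in H. rewrite Cmod_mult, Hc, Cmod_1 in H. lra.
Qed.

Lemma psum_linear_recurrence (a b : nat -> C) (c z : C) :
  disk_bounded a -> disk_bounded b -> in_disk z ->
  (forall n, a (S n) = c * a n + b n) ->
  psum a z = a 0%nat + z * (c * psum a z + psum b z).
Proof.
  intros Ha Hb Hz Hrec.
  assert (H1 := psum_correct a z Ha Hz). assert (H2 := psum_correct b z Hb Hz).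
  rewrite (psum_shift a z _ Ha Hz H1) at 1. do 2 f_equal.
  apply (is_pseries_C_unique (fun n => a (S n)) z).
  - apply psum_correct; [apply disk_bounded_shift, Ha|exact Hz].
  - apply is_pseries_C_iff in H1, H2.
    assert (H3 := is_series_plus _ _ _ _ (is_series_scal (V := C_NormedModule) c _ _ H1) H2).
    apply is_pseries_C_iff. revert H3. apply is_series_C_ext; [|reflexivity].
    intros n. change (c * (z ^ n * a n) + z ^ n * b n = z ^ n * a (S n)). rewrite Hrec. ring.
Qed.

(** The coefficient sequences satisfy linear recurrences, which turn into linear
    equations for the sums: [S1 = 1 + z c S1] for the geometric series and
    [S2 = z (c S2 + S1)] for the series of [n c^(n-1) z^n]. *)
Lemma koebe_rotation_taylor (c : C) (f : C -> C) :
  is_koebe_rotation c f -> taylor_expansion f (koebe_coefficient c).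
Proof.
  intros [Hc Hf] z Hz.
  assert (Hunit : forall k : nat -> nat, disk_bounded (fun n => c ^ k n)).
  { intros k rho Hrho. exists 1%R. intros n.
    rewrite Cmod_pow, Hc, pow1, Rmult_1_l. rewrite <- (pow1 n). apply pow_incr. lra. }
  assert (H0 : disk_bounded (fun _ => RtoC 0)).
  { intros rho Hrho. exists 0%R. intros n. rewrite Cmod_0. lra. }
  assert (Hgeom : disk_bounded (fun n => c ^ n)) by exact (Hunit (fun n => n)).
  assert (Hk : disk_bounded (koebe_coefficient c))
    by exact (disk_bounded_mult_nat _ (Hunit pred)).
  assert (Hd := one_sub_mult_neq_0 c z Hc Hz).
  assert (HZ : psum (fun _ => RtoC 0) z = 0).
  { apply (is_pseries_C_unique _ _ _ _ (psum_correct _ z H0 Hz)).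
    apply is_pseries_C_iff. generalize is_series_C_zero.
    apply is_series_C_ext; [intros n; ring|reflexivity]. }
  assert (E1 := psum_linear_recurrence (fun n => c ^ n) (fun _ => RtoC 0) c z Hgeom H0 Hz
    ltac:(intros n; simpl; ring)).
  assert (E2 := psum_linear_recurrence (koebe_coefficient c) (fun n => c ^ n) c z Hk Hgeom Hz
    ltac:(intros [|n]; unfold koebe_coefficient; rewrite S_INR, RtoC_plus; simpl; ring)).
  rewrite HZ in E1. cbv beta in E1. simpl (c ^ 0) in E1.
  replace (koebe_coefficient c 0) with (RtoC 0) in E2 by (unfold koebe_coefficient; simpl; ring).
  set (S1 := psum (fun n => c ^ n) z) in *. set (S2 := psum (koebe_coefficient c) z) in *.
  assert (F1 : S1 = / (1 - c * z)).
  { replace (/ (1 - c * z)) with ((S1 - z * c * S1) * / (1 - c * z)).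
    - field. exact Hd.
    - rewrite E1 at 1. field. exact Hd. }
  assert (F2 : f z = S2).
  { rewrite (Hf z).
    replace (z / (1 - c * z) ^ 2) with (z * S1 * / (1 - c * z)) by (rewrite F1; field; exact Hd).
    replace (z * S1) with (S2 - z * c * S2); [field; exact Hd|].
    rewrite E2 at 1. ring. }
  rewrite F2. apply psum_correct; assumption.
Qed.

Lemma koebe_rotation_class_U (c : C) (f : C -> C) :
  is_koebe_rotation c f -> class_U f.
Proof.
  intros Hk. assert (HT := koebe_rotation_taylor c f Hk). destruct Hk as [Hc Hf].
  assert (Hd := fun z => one_sub_mult_neq_0 c z Hc).
  assert (Hd2 : forall z, in_disk z -> (1 - c * z) ^ 2 <> 0).
  { intros z Hz E. apply (f_equal Cmod) in E. rewrite Cmod_pow, Cmod_0 in E.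
    assert (H := proj1 (Cmod_gt_0 _) (Hd z Hz)). nra. }
  split; [split|split].
  - assert (Hh : holo 1 (fun z => z * / (1 - c * z) ^ 2)).
    { apply holo_mult; [apply holo_id|]. apply (holo_inv 1 (fun z => (1 - c * z) ^ 2)); [|exact Hd2].
      apply (holo_pow 1 2). apply holo_minus; [apply holo_const|].
      apply holo_mult; [apply holo_const|apply holo_id]. }
    destruct Hh as [f' [Hf' _]]. intros z Hz. exists (f' z).
    refine (is_derive_C_ext_disk _ f z _ _ Hz (Hf' z Hz)). intros w _. symmetry. apply Hf.
  - exists (koebe_coefficient c). split; [|split; [|exact HT]].
    + unfold koebe_coefficient. simpl. ring.
    + unfold koebe_coefficient. simpl. ring.
  - intros z Hz Hz0 E. apply Hz0. replace z with (f z * (1 - c * z) ^ 2).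
    + rewrite E. ring.
    + rewrite (Hf z). field. apply Hd, Hz.
  - intros z Hz.
    rewrite (U_functional_of_reciprocal f (fun w => c * c * w) (c * c) (2 * c) z).
    + rewrite Cmod_opp, !Cmod_mult, Cmod_pow, Hc. unfold in_disk in Hz.
      generalize (Cmod_ge_0 z). nra.
    + intros w Hw. replace (1 - 2 * c * w + w * (c * c * w)) with ((1 - c * w) ^ 2) by ring.
      split; [|apply Hd2, Hw]. rewrite (Hf w). field. apply Hd, Hw.
    + exact Hz.
    + eapply is_derive_C_eq.
      * apply is_derive_Cmult; [apply is_derive_Cconst|apply is_derive_Cid].
      * cbv beta. ring.
Qed.

Lemma koebe_rotation_equality (c : C) (f : C -> C) (a : nat -> C) :
  is_koebe_rotation c f -> taylor_expansion f a ->
  Cmod (a 2%nat * a 3%nat - a 4%nat) = 2%R /\ Cmod (a 2%nat * a 4%nat - a 5%nat) = 3%R.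
Proof.
  intros Hk Ha.
  assert (Hc := proj1 Hk).
  rewrite !(taylor_coefficient_unique f a _ Ha
    (koebe_rotation_taylor c f Hk)).
  unfold koebe_coefficient. rewrite !INR_IZR_INZ. simpl (Z.of_nat _). simpl pred.
  split.
  - replace (RtoC 2 * c ^ 1 * (RtoC 3 * c ^ 2) - RtoC 4 * c ^ 3) with (RtoC 2 * c ^ 3) by (simpl; ring).
    rewrite Cmod_mult, Cmod_pow, Hc, Cmod_R, Rabs_pos_eq; lra.
  - replace (RtoC 2 * c ^ 1 * (RtoC 4 * c ^ 3) - RtoC 5 * c ^ 4) with (RtoC 3 * c ^ 4) by (simpl; ring).
    rewrite Cmod_mult, Cmod_pow, Hc, Cmod_R, Rabs_pos_eq; lra.
Qed.

Lemma Cmod_cis (theta : R) : Cmod (cis theta) = 1%R.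
Proof.
  unfold Cmod, cis. simpl fst. simpl snd.
  rewrite <- !Rsqr_pow2, Rplus_comm, sin2_cos2. apply sqrt_1.
Qed.

Lemma cis_opp_mult (theta : R) : cis (- theta) * cis theta = 1.
Proof.
  unfold cis. rewrite cos_neg, sin_neg.
  generalize (sin2_cos2 theta). unfold Rsqr. intros H.
  unfold Cmult, RtoC. simpl. f_equal; lra.
Qed.

Lemma koebe_is_koebe_rotation : is_koebe_rotation 1 koebe.
Proof.
  split; [apply Cmod_1|]. intros z. unfold koebe. rewrite Cmult_1_l. reflexivity.
Qed.

Lemma rotation_is_koebe_rotation (theta : R) :
  is_koebe_rotation (cis theta) (rotation theta koebe).
Proof.
  split; [apply Cmod_cis|]. intros z. unfold rotation, koebe, Cdiv.
  rewrite !Cmult_assoc, cis_opp_mult, Cmult_1_l. reflexivity.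
Qed.

Theorem theorem2 :
  (forall (f : C -> C) (a : nat -> C),
     class_U f -> taylor_expansion f a ->
     (Cmod (a 2%nat * a 3%nat - a 4%nat) <= 2)%R /\
     (Cmod (a 2%nat * a 4%nat - a 5%nat) <= 3)%R) /\
  taylor_expansion koebe (fun n : nat => RtoC (INR n)) /\
  (forall f : C -> C,
     (f = koebe \/ exists theta : R, f = rotation theta koebe) ->
     class_U f /\
     forall a : nat -> C, taylor_expansion f a ->
       Cmod (a 2%nat * a 3%nat - a 4%nat) = 2%R /\
       Cmod (a 2%nat * a 4%nat - a 5%nat) = 3%R).
Proof.
  split; [exact class_U_coefficient_bounds|split].
  - intros z Hz. generalize (koebe_rotation_taylor 1 koebe koebe_is_koebe_rotation z Hz).
    apply is_series_C_ext; [|reflexivity]. intros n. unfold koebe_coefficient.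
    now rewrite Cpow_1_l, Cmult_1_r.
  - intros f Hf.
    assert (Hc : exists c, is_koebe_rotation c f).
    { destruct Hf as [->|[theta ->]].
      - exists (RtoC 1). exact koebe_is_koebe_rotation.
      - exists (cis theta). apply rotation_is_koebe_rotation. }
    destruct Hc as [c Hc]. split.
    + exact (koebe_rotation_class_U c f Hc).
    + intros a Ha. exact (koebe_rotation_equality c f a Hc Ha).
Qed.
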